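(* Consider the $K$-armed bandit problem with normal rewards having unknown and possibly unequal variances, where either $K=N^{\zeta+o(1)}\to\infty$ for some $0<\zeta<1$, or $K$ is fixed (and $\zeta=0$), as $N\to\infty$. Let the algorithm be UCB-Large with confidence bounds $$U_k^n=\bar X_{kn_k}+\widehat\sigma_{kn_k}\sqrt{\exp\Big(\frac{2\log(n/K^{1-q})}{n_k-1}\Big)-1}\quad\text{for some }q>0,\ \text{if }K\to\infty,$$ or $$U_k^n=\bar X_{kn_k}+\widehat\sigma_{kn_k}\sqrt{\exp\Big(\frac{2b_{n/K}}{n_k-1}\Big)-1},\quad b_m=\log m+\alpha\log(1+\log m)\text{ for some }\alpha>1,\ \text{if }K\text{ is fixed}.$$ For $\Delta_K\to0$ at a sub-polynomial rate, $$\limsup_{N\to\infty}\Big[\sup_{\boldsymbol{\theta}\in\Theta_2(\Delta_K)}\frac{\widetilde R_N(\boldsymbol{\theta})}{r(\boldsymbol{\theta})\log N}\Big]\ \le\ 1-\zeta+\zeta q$$ (where $\zeta q=0$ if $K$ is fixed).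
   Context: Setting: there are $K=K(N)$ arms and a total of $N$ rewards is to be collected. The rewards $X_{k1},X_{k2},\ldots$ of arm $k$ are i.i.d. $N(\mu_k,\sigma_k^2)$, independent across arms; $\theta_k=(\mu_k,\sigma_k^2)$ with $\sigma_k^2>0$, $\boldsymbol{\theta}=\boldsymbol{\theta}_K=(\theta_1,\ldots,\theta_K)$, $\boldsymbol{\mu}=(\mu_1,\ldots,\mu_K)$, $\mu_*=\max_k\mu_k$, and $E_{\boldsymbol{\theta}}$ denotes expectation under $\boldsymbol{\theta}$. $\bar X_{ks}=\frac1s\sum_{t=1}^sX_{kt}$ and $\widehat\sigma_{ks}^2=s^{-1}\sum_{t=1}^s(X_{kt}-\bar X_{ks})^2$. UCB-Large: when there are $n$ total rewards, $n_k$ denotes the number of them from arm $k$. Initialize with two rewards from each arm (so $n=2K$). For $n=2K,\ldots,N-1$: compute the confidence bounds $U_k^n$, $1\le k\le K$, and draw the next reward from an arm with the largest confidence bound. $N_k$ is the number of rewards from arm $k$ among the $N$ total rewards. Let $\widetilde R_N(\boldsymbol{\theta})=\sum_{k=1}^K(\mu_*-\mu_k)E_{\boldsymbol{\theta}}(N_k-1)^+$, where $a^+=\max(a,0)$. Let $M(z)=\frac12\log(1+z^2)$, $r(\boldsymbol{\theta})=\sum_{k:\mu_k<\mu_*}\frac{\mu_*-\mu_k}{M\left(\frac{\mu_*-\mu_k}{\sigma_k}\right)}$ and $J(\boldsymbol{\mu})=\#\{k:\mu_k<\mu_*\}$. $(\Delta_K)$ is a sequence of positive numbers indexed by the number of arms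 $K$ (so it is a constant as $N\to\infty$ when $K$ is fixed); $\Delta_K\to0$ at a sub-polynomial rate means that, as $K\to\infty$, $\Delta_K\to0$ and $\Delta_K K^{\epsilon}\to\infty$ for all $\epsilon>0$. $$\Theta_2(\Delta_K)=\Big\{\boldsymbol{\theta}_K:\ \max_{k:\mu_k<\mu_*}\mu_k\le\mu_*-\Delta_K,\ \max_k|\mu_k|\le\Delta_K^{-1},\ \Delta_K\le\sigma_k\le\Delta_K^{-1}\text{ for all }k,\ J(\boldsymbol{\mu})\ge\Delta_K K\Big\}.$$ (A supremum over an empty parameter set is taken as $0$.) *)

(* Defs.v *)
From HB Require Import structures.
From mathcomp Require Import all_boot all_order all_algebra.
From mathcomp Require Import all_classical all_reals all_analysis.

Set Implicit Arguments.
Unset Strict Implicit.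
Unset Printing Implicit Defensive.

Import Order.TTheory GRing.Theory Num.Theory.
Import numFieldNormedType.Exports.

Local Open Scope classical_set_scope.
Local Open Scope ring_scope.

Section parameters.
Variable (R : realType) (K : nat).

(* theta k = (mu_k, sigma_k ^ 2): the second component is the variance. *)
Definition param := 'I_K -> R * R.

Implicit Type theta : param.

Definition mean theta (k : 'I_K) : R := (theta k).1.
Definition var theta (k : 'I_K) : R := (theta k).2.
Definition sd theta (k : 'I_K) : R := Num.sqrt (var theta k).

(* A maximum when 0 < K. *)
Definition best_mean theta : R := sup (range (mean theta)).

Definition gap theta (k : 'I_K) : R := best_mean theta - mean theta k.

Definition suboptimal theta (k : 'I_K) : bool := mean theta k < best_mean theta.

Definition num_suboptimal theta : nat := #|[pred k | suboptimal theta k]|.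

Definition M (z : R) : R := 2^-1 * ln (1 + z ^+ 2).

Definition rate theta : R :=
  \sum_(k < K | suboptimal theta k) gap theta k / M (gap theta k / sd theta k).

Definition Theta2 (D : R) : set param :=
  [set theta |
    [/\ forall k, suboptimal theta k -> mean theta k <= best_mean theta - D,
        forall k, `|mean theta k| <= D^-1,
        forall k, D <= sd theta k <= D^-1
      & D * K%:R <= (num_suboptimal theta)%:R]].

End parameters.

Section rewards.
Context (R : realType) (d : measure_display) (Omega : measurableType d).

Definition mutually_independent (P : probability Omega R) (I : eqType)
    (X : I -> Omega -> R) : Prop :=
  forall (s : seq I) (A : I -> set R), uniq s ->
    (forall i, i \in s -> measurable (A i)) ->
    P (\big[setI/setT]_(i <- s) (X i @^-1` A i)) =
    (\prod_(i <- s) P (X i @^-1` A i))%E.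

(* X k t is the (t + 1)-st reward of arm k, and P theta the probability
   measure that governs the rewards under theta. *)
Definition normal_arms (K : nat) (P : param R K -> probability Omega R)
    (X : 'I_K -> nat -> {mfun Omega >-> R}) : Prop :=
  forall theta : param R K, (forall k, 0 < var theta k) ->
    (forall k t (A : set R), measurable A ->
       distribution (P theta) (X k t) A =
       normal_prob (mean theta k) (sd theta k) A) /\
    mutually_independent (P theta) (fun i : 'I_K * nat => X i.1 i.2 : Omega -> R).

Variable K : nat.
Variable X : 'I_K -> nat -> Omega -> R.

(* pull n w is the arm that yields the (n + 1)-st reward overall. *)
Variable pull : nat -> Omega -> 'I_K.

(* The number n_k of rewards from arm k among the first n rewards. *)
Definition npulls (k : 'I_K) (n : nat) (w : Omega) : nat :=
  \sum_(i < n) (pull i w == k).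

Definition sample_mean (k : 'I_K) (s : nat) (w : Omega) : R :=
  (\sum_(t < s) X k t w) / s%:R.

Definition sample_sd (k : 'I_K) (s : nat) (w : Omega) : R :=
  Num.sqrt ((\sum_(t < s) (X k t w - sample_mean k s w) ^+ 2) / s%:R).

(* lev n is the confidence level at which the bound is computed when there are
   n rewards in total: log (n / K ^ (1 - q)) or b_(n / K). *)
Definition conf_bound (lev : nat -> R) (k : 'I_K) (n : nat) (w : Omega) : R :=
  let s := npulls k n w in
  sample_mean k s w +
  sample_sd k s w * Num.sqrt (expR (2 * lev n / (s%:R - 1)) - 1).

(* Neither the order of the 2 K initial draws nor the rule for breaking ties
   between maximal confidence bounds is prescribed. *)
Definition ucb_large (lev : nat -> R) (N : nat) : Prop :=
  [/\ forall n k, measurable [set w | pull n w = k],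
      forall k w, npulls k (2 * K) w = 2%N
    & forall n w, (2 * K <= n < N)%N ->
        forall k, conf_bound lev k n w <= conf_bound lev (pull n w) n w].

Definition regret (P : param R K -> probability Omega R) (N : nat)
    (theta : param R K) : \bar R :=
  (\sum_(k < K) (gap theta k)%:E *
     'E_(P theta)[fun w => (Num.max ((npulls k N w)%:R - 1) 0)%R])%E.

End rewards.

Section levels.
Variable R : realType.

Definition lev_growing (q : R) (K n : nat) : R :=
  ln (n%:R / (K%:R `^ (1 - q))).

Definition b (alpha m : R) : R := ln m + alpha * ln (1 + ln m).

Definition lev_fixed (alpha : R) (K n : nat) : R := b alpha (n%:R / K%:R).

(* K = N ^ (zeta + o(1)). *)
Definition power_growth (K : nat -> nat) (zeta : R) : Prop :=
  exists2 e : nat -> R, e @ \oo --> (0 : R) &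
    \forall N \near \oo, (K N)%:R = N%:R `^ (zeta + e N).

Definition subpolynomial_decay (Delta : nat -> R) : Prop :=
  Delta @ \oo --> (0 : R) /\
  forall eps : R, 0 < eps -> (fun k => Delta k * k%:R `^ eps) @ \oo --> +oo.

(* Least upper bound of the values of f on A, taken as 0 when A is empty
   (ereal_sup set0 is -oo). *)
Definition sup_over (T : Type) (A : set T) (f : T -> \bar R) : \bar R :=
  if `[< A = set0 >] then 0%E else ereal_sup (f @` A).

End levels.

(* Main.v *)
Require Import Defs.
From HB Require Import structures.
From mathcomp Require Import all_boot all_order all_algebra.
From mathcomp Require Import all_classical all_reals all_analysis.
From mathcomp Require Import measurable_realfun normal_distribution ring lra.

Set Implicit Arguments.
Unset Strict Implicit.
Unset Printing Implicit Defensive.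

Import Order.TTheory GRing.Theory Num.Theory.
Import numFieldNormedType.Exports.

Local Open Scope classical_set_scope.
Local Open Scope ring_scope.

(* A reward of a suboptimal arm k drawn when it has s rewards requires either
   that its confidence bound exceeds mu_* - eps Delta, or that the bound of a best
   arm is below that level.

   In the first case, unless its sample mean or standard deviation is too large
   (an event whose probabilities are summable over s), s - 1 is at most
   (confidence level) / M((1 - O(eps)) gap / sd), which yields the main term.

   In the second case, a Chernoff bound for the self-normalised mean of s normal
   rewards at confidence level l gives probability O(s exp(-l - c s)), where c > 0
   comes from the margin eps Delta. The union bound over s costs a factor
   Delta^-O(1), and the sum over n of exp(-level n) is of order K^(1-q) log N, respectively
   o(log N) for fixed K. Since the rate is at least K Delta^O(1), and Delta^-1 is
   a subpolynomial function of K, this is negligible. *)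

(** * Gaussian integrals and independence *)

(** The number of draws of an arm depends on all past rewards, so no tail bound applies directly at
    the current count. The argument is therefore pathwise: the draws enter only through inequalities
    valid at every outcome, and probabilities are taken only of events at a deterministic count [s].
    Overestimation events do not involve [n], and each [s] is the current count at only one draw of
    the arm, so they need no sum over [n]. Underestimation events do depend on [n], through the
    level; since one arm is drawn at a time, their cost is not multiplied by [K].

    The supremum over parameters stands inside the limit and ranges over sets that change with [N].
    Hence every bound before the limit is non-asymptotic, with explicit powers of [Delta], and [eps]
    stays fixed while [N] grows.

    In the self-normalised Chernoff bound the mean enters squared. A tilt by [s / 2] would give an
    infinite expectation; [(s - 1) / 2] keeps it finite and matches the [s - 1] in the confidence
    bound. *)

Section transfer.
Local Open Scope ereal_scope.
Context d1 d2 (T1 : measurableType d1) (T2 : measurableType d2) (R : realType).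
Variables (m1 : {measure set T1 -> \bar R}) (m2 : {measure set T2 -> \bar R}).
Variables (phi : T2 -> T1) (mphi : measurable_fun setT phi).
Variables (Y : T2 -> R) (mY : measurable_fun setT Y).
Hypothesis Y0 : forall x, (0 <= Y x)%R.
Variable c : R.
Hypothesis transfer : forall A, measurable A ->
  \int[m2]_x (Y x * \1_A (phi x))%:E = c%:E * m1 A.

Import HBNNSimple.

Let transfer_nnsfun (h : {nnsfun T1 >-> R}) :
  \int[m2]_x ((Y x)%:E * (h (phi x))%:E) = c%:E * \int[m1]_x (h x)%:E.
Proof.
have mYr r : measurable_fun [set: T2]
    (fun x => (Y x * \1_(h @^-1` [set r]) (phi x))%:E).
  apply/measurable_EFinP/measurable_funM => //.
  by apply: (measurableT_comp _ mphi); exact: measurable_indic.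
transitivity (\sum_(r \in range h)
    \int[m2]_x (r%:E * (Y x * \1_(h @^-1` [set r]) (phi x))%:E)).
  rewrite -ge0_integral_fsum//; last 2 first.
  - by move=> r; apply: measurable_funeM; exact: mYr.
  - move=> r x _; rewrite -EFinM mulrCA EFinM.
    by rewrite mule_ge0 ?lee_fin// -lee_fin nnfun_muleindic_ge0.
  apply: eq_integral => x _; rewrite fimfunE -fsumEFin//.
  rewrite ge0_mule_fsumr; last by move=> r; rewrite nnfun_muleindic_ge0.
  by apply: eq_fsbigr => r _; rewrite -!EFinM mulrCA.
under eq_integral do rewrite fimfunE -fsumEFin//.
rewrite ge0_integral_fsum//; last 2 first.
- by move=> r; exact/measurable_EFinP/measurable_funM.
- by move=> r x _; rewrite nnfun_muleindic_ge0.
rewrite ge0_mule_fsumr; last first.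
  by move=> r; apply: integral_ge0 => x _; rewrite nnfun_muleindic_ge0.
apply: eq_fsbigr => r /[!inE] -[y _ hyr].
have r0 : (0 <= r)%R by rewrite -hyr.
rewrite integralZl_indic_nnsfun// integral_indic// setIT.
rewrite ge0_integralZl//; first by rewrite transfer// muleCA.
by move=> x _; rewrite lee_fin mulr_ge0.
Qed.

(** The hypothesis on indicators extends to simple functions by linearity and to nonnegative
    functions by monotone convergence. It serves twice: with [phi] the identity and [Y] a density,
    and with [phi] one of several independent variables and [Y] a function of the others. *)
Lemma ge0_integral_transfer (f : T1 -> \bar R) :
  measurable_fun setT f -> (forall x, 0 <= f x) ->
  \int[m2]_x ((Y x)%:E * f (phi x)) = c%:E * \int[m1]_x f x.
Proof.
move=> mf f0; pose g := nnsfun_approx measurableT mf.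
have gf x : (g n x)%:E @[n --> \oo] --> f x by exact: cvg_nnsfun_approx.
have ndg x : {homo (fun n => (g n x)%:E) : a b / (a <= b)%N >-> a <= b}.
  by move=> a b ab; rewrite lee_fin; exact/lefP/nd_nnsfun_approx.
transitivity (limn (fun n => \int[m2]_x ((Y x)%:E * (g n (phi x))%:E))).
  rewrite -monotone_convergence//.
  - apply: eq_integral => x _; apply/esym/cvg_lim => //.
    exact: cvgeZl.
  - move=> n; apply: emeasurable_funM => //; apply: measurableT_comp => //.
    exact: measurableT_comp.
  - by move=> n x _; rewrite mule_ge0// lee_fin.
  - by move=> x _ a b ab; rewrite lee_wpmul2l ?lee_fin//;
      exact/lefP/nd_nnsfun_approx.
rewrite (_ : \int[m1]_x f x = limn (fun n => \int[m1]_x (g n x)%:E)).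
  rewrite -limeMl//; first by congr (limn _); apply/funext => n.
  apply/ereal_nondecreasing_is_cvgn => a b ab; apply: ge0_le_integral => //.
  - by move=> x _; rewrite lee_fin.
  - exact/measurable_EFinP.
  - exact/measurable_EFinP.
  - by move=> x _; exact: ndg.
rewrite -monotone_convergence//.
- by apply: eq_integral => x _; apply/esym/cvg_lim.
- by move=> n; exact/measurable_EFinP.
- by move=> n x _; rewrite lee_fin.
Qed.

End transfer.

(** * Gaussian integrals of exponentials of quadratics *)

Section gaussian.
Context (R : realType).

(** Completing the square: with [v = 1 - 2 * b], the integrand is a constant times the normal
    density of mean [m + a * sigma / v] and standard deviation [sigma / Num.sqrt v]. *)
Lemma lebesgue_expR_quadratic (m sigma a b : R) : 0 < sigma -> b < 2^-1 ->
  (\int[lebesgue_measure]_x ((normal_pdf m sigma x)%:E *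
     (expR (a * ((x - m) / sigma) + b * ((x - m) / sigma) ^+ 2))%:E) =
   ((Num.sqrt (1 - 2 * b))^-1 * expR (a ^+ 2 / (2 * (1 - 2 * b))))%:E)%E.
Proof.
move=> s0 b2; set v := 1 - 2 * b.
have v0 : 0 < v by rewrite /v; lra.
have bv : b = (1 - v) / 2 by rewrite /v; field.
clearbody v.
have sv0 : 0 < Num.sqrt v by rewrite sqrtr_gt0.
set C := (_ * _)%R.
have C0 : 0 <= C by rewrite mulr_ge0 ?invr_ge0 ?sqrtr_ge0 ?expR_ge0.
pose sigma' := sigma / Num.sqrt v.
pose m' := m + a * sigma / v.
have s'0 : 0 < sigma' by rewrite divr_gt0.
transitivity (\int[lebesgue_measure]_x (C%:E * (normal_pdf m' sigma' x)%:E))%E.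
  apply: eq_integral => x _; rewrite -!EFinM; congr EFin; move: x => /= x.
  rewrite !normal_pdfE ?gt_eqF// /C /=.
  have -> : normal_peak sigma = normal_peak sigma' / Num.sqrt v.
    rewrite /normal_peak -invfM; congr _^-1.
    rewrite -sqrtrM; last by rewrite mulrn_wge0// mulr_ge0 ?sqr_ge0 ?pi_ge0.
    congr Num.sqrt; rewrite /sigma' expr_div_n sqr_sqrtr ?ltW//.
    by move: (pi) => p; field; rewrite gt_eqF.
  suff E : normal_fun m sigma x *
      expR (a * ((x - m) / sigma) + b * ((x - m) / sigma) ^+ 2) =
      expR (a ^+ 2 / (2 * v)) * normal_fun m' sigma' x.
    transitivity (normal_peak sigma' / Num.sqrt v * (normal_fun m sigma x *
      expR (a * ((x - m) / sigma) + b * ((x - m) / sigma) ^+ 2))); first by ring.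
    by rewrite E; ring.
  rewrite /normal_fun -!expRD; congr expR.
  have -> : sigma' ^+ 2 = sigma ^+ 2 / v by rewrite expr_div_n sqr_sqrtr ?ltW.
  rewrite /m' bv.
  by field; rewrite !gt_eqF.
rewrite ge0_integralZl//; first by rewrite integral_normal_pdf mule1.
- by apply/measurable_EFinP; exact: measurable_normal_pdf.
- by move=> x _; rewrite lee_fin normal_pdf_ge0.
Qed.

Lemma measurable_expR_quadratic (a b : R) :
  measurable_fun setT (fun x : R => expR (a * x + b * x ^+ 2)).
Proof.
apply: measurableT_comp => //; apply: measurable_funD.
  exact: measurable_funM.
by apply: measurable_funM => //; exact: measurable_funX.
Qed.

Lemma std_normal_expR_quadratic (a b : R) : b < 2^-1 ->
  (\int[lebesgue_measure]_x (normal_pdf 0 1 x * expR (a * x + b * x ^+ 2))%:E =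
   ((Num.sqrt (1 - 2 * b))^-1 * expR (a ^+ 2 / (2 * (1 - 2 * b))))%:E)%E.
Proof.
move=> b2; rewrite -(@lebesgue_expR_quadratic 0 1)//.
by apply: eq_integral => x _; rewrite subr0 divr1 EFinM.
Qed.

Variables (mu : {measure set R -> \bar R}) (m sigma : R).
Hypothesis mu_normal : forall A, measurable A -> mu A = normal_prob m sigma A.

Lemma integral_normal_probE (f : R -> \bar R) :
  measurable_fun setT f -> (forall x, 0 <= f x)%E ->
  (\int[mu]_x f x =
   \int[lebesgue_measure]_x ((normal_pdf m sigma x)%:E * f x))%E.
Proof.
move=> mf f0; rewrite -[LHS]mul1e; apply/esym.
have tr (A : set R) : measurable A ->
    (\int[lebesgue_measure]_x (normal_pdf m sigma x * \1_A (id x))%:E = 1%:E * mu A)%E.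
  move=> mA; rewrite mul1e mu_normal// /normal_prob [RHS]integral_mkcond epatch_indic.
  by apply: eq_integral => x _; rewrite EFinM.
have mid : measurable_fun setT (id : measurableTypeR R -> R) by [].
have mY : measurable_fun setT (normal_pdf m sigma : measurableTypeR R -> R).
  exact: measurable_normal_pdf.
exact: (ge0_integral_transfer mid mY (normal_pdf_ge0 m sigma) tr mf f0).
Qed.

Lemma normal_expR_quadratic (a b : R) : 0 < sigma -> b < 2^-1 ->
  (\int[mu]_x
     (expR (a * ((x - m) / sigma) + b * ((x - m) / sigma) ^+ 2))%:E =
   ((Num.sqrt (1 - 2 * b))^-1 * expR (a ^+ 2 / (2 * (1 - 2 * b))))%:E)%E.
Proof.
move=> s0 b2; rewrite integral_normal_probE//.
  by rewrite lebesgue_expR_quadratic.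
apply/measurable_EFinP.
have mu0 : measurable_fun setT (fun x : R => (x - m) / sigma).
  by apply: measurable_funM => //; exact: measurable_funB.
exact: (measurableT_comp (measurable_expR_quadratic a b) mu0).
Qed.

End gaussian.

(** * Expectations of products of independent variables *)

Section independence.
Context (R : realType) (d : measure_display) (Omega : measurableType d).
Variables (P : probability Omega R) (I : eqType) (X : I -> {mfun Omega >-> R}).
Hypothesis indX : mutually_independent P (fun i => X i : Omega -> R).
Variables (f : I -> R -> R) (c : I -> R).
Hypothesis mf : forall i, measurable_fun setT (f i).
Hypothesis f0 : forall i x, 0 <= f i x.
Hypothesis fE : forall i, (\int[distribution P (X i)]_x (f i x)%:E = (c i)%:E)%E.

Let c_ge0 i : 0 <= c i.
Proof. by rewrite -lee_fin -fE integral_ge0// => x _; rewrite lee_fin. Qed.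

(** Independence is given for events only. The mixed product allows an induction that turns one
    indicator at a time into [f i]: the induction hypothesis with [i] moved to the indicator list is
    the premise of [ge0_integral_transfer] for the law of [X i]. *)
Let expectation_prod_indic (s1 s2 : seq I) (A : I -> set R) :
  uniq (s1 ++ s2) -> (forall i, measurable (A i)) ->
  (\int[P]_w (\prod_(i <- s1) f i (X i w) * \prod_(i <- s2) \1_(A i) (X i w))%:E =
   (\prod_(i <- s1) c i)%:E * \prod_(i <- s2) P (X i @^-1` A i))%E.
Proof.
elim: s1 s2 A => [|i s1 IH] s2 A us mA.
  rewrite big_nil mul1e -indX//=.
  rewrite -[RHS]mule1 -[in RHS](setIT (\big[setI/setT]_(_ <- _) _)) -integral_indic//.
    rewrite muleC mul1e; apply: eq_integral => w _; rewrite big_nil mul1r; congr EFin.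
    elim: s2 {us} => [|j s2 IH2]; first by rewrite !big_nil indicT.
    by rewrite !big_cons indicI IH2.
  elim: s2 {us} => [|j s2 IH2]; first by rewrite big_nil.
  rewrite big_cons; apply: measurableI => //.
  by rewrite -[X in measurable X]setTI; exact: measurable_funP.
pose Y w := \prod_(i <- s1) f i (X i w) * \prod_(i <- s2) \1_(A i) (X i w).
transitivity (\int[P]_w ((Y w)%:E * (f i (X i w))%:E))%E.
  by apply: eq_integral => w _; rewrite -EFinM big_cons /Y; congr EFin; ring.
pose q := fine (\prod_(i <- s2) P (X i @^-1` A i))%E.
have qE : (\prod_(i <- s2) P (X i @^-1` A i))%E = q%:E.
  rewrite fineK//; elim: s2 {us Y q} => [|j s2 IH2]; first by rewrite big_nil.
  rewrite big_cons fin_numM// fin_num_measure// -[X in measurable X]setTI.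
  exact: measurable_funP.
have q0 : 0 <= q.
  by rewrite -lee_fin -qE; elim/big_ind : _ => // x y; exact: mule_ge0.
have mY : measurable_fun setT Y.
  apply: measurable_funM; apply: measurable_prod => j _.
    exact: measurableT_comp.
  by apply: measurableT_comp => //; exact: measurable_indic.
have Y0 w : 0 <= Y w by rewrite mulr_ge0// prodr_ge0.
have transferY B : measurable B -> (\int[P]_w (Y w * \1_B (X i w))%:E =
    (\prod_(i <- s1) c i * q)%:E * distribution P (X i) B)%E.
  (* [A'] puts [B] at [i]; as the list has no repetition, the indices in [s2] keep their sets. *)
  move=> mB; pose A' j := if j == i then B else A j.
  have us' : uniq (s1 ++ i :: s2) by rewrite (uniq_catCA s1 [:: i] s2).
  have is2 : i \notin s2.
    by move: us => /=; rewrite mem_cat negb_or => /andP[/andP[]].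
  have mA' j : measurable (A' j) by rewrite /A'; case: ifP.
  have A's2 (T : Type) idx (op : T -> T -> T) (F : I -> set R -> T) :
     \big[op/idx]_(j <- s2) F j (A' j) = \big[op/idx]_(j <- s2) F j (A j).
    rewrite big_seq [RHS]big_seq; apply: eq_bigr => j js2.
    by rewrite /A' ifN//; apply: contraNneq is2 => <-.
  have A'i : A' i = B by rewrite /A' eqxx.
  have := IH (i :: s2) A' us' mA'; rewrite big_cons A'i.
  rewrite (A's2 _ _ _ (fun j C => P (X j @^-1` C))) qE => IH'.
  rewrite EFinM -muleA (muleC q%:E) -IH'.
  apply: eq_integral => w _; rewrite big_cons A'i.
  by rewrite (A's2 _ _ _ (fun j C => \1_C (X j w))) /Y; congr EFin; ring.
have mphi : measurable_fun setT (X i) by [].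
rewrite (ge0_integral_transfer mphi mY Y0 transferY (f := EFin \o f i))//.
- by rewrite fE big_cons qE -!EFinM; congr EFin; ring.
- exact/measurable_EFinP.
- by move=> x; rewrite lee_fin.
Qed.

Lemma independent_expectation_prod (s : seq I) : uniq s ->
  (\int[P]_w (\prod_(i <- s) f i (X i w))%:E = (\prod_(i <- s) c i)%:E)%E.
Proof.
move=> us; have := @expectation_prod_indic s [::] (fun=> setT).
rewrite cats0 big_nil mule1 => <- //; apply: eq_integral => w _.
by rewrite big_nil mulr1.
Qed.

End independence.

(** * Tails of the sample mean and standard deviation *)

(** Markov's inequality, in the form used for every Chernoff bound below. *)
Lemma prob_le_integral (R : realType) (d : measure_display)
    (Omega : measurableType d) (P : probability Omega R)
    (E : set Omega) (g : Omega -> R) :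
  measurable E -> measurable_fun setT g -> (forall w, 0 <= g w) ->
  (forall w, E w -> 1 <= g w) -> (P E <= \int[P]_w (g w)%:E)%E.
Proof.
move=> mE mg g0 g1; rewrite -[E in P E]setIT -integral_indic//.
apply: ge0_le_integral => //.
- by apply/measurable_EFinP; exact: measurable_indic.
- exact/measurable_EFinP.
- move=> w _; rewrite lee_fin indicE; case: (boolP (w \in E)) => //.
  by rewrite inE => /g1.
Qed.

Section normal_sample.
Context (R : realType) (d : measure_display) (Omega : measurableType d).
Variables (P : probability Omega R) (K : nat) (X : 'I_K -> nat -> {mfun Omega >-> R}).
Variables (k : 'I_K) (m sigma : R).
Hypothesis sigma_gt0 : 0 < sigma.
Hypothesis normalX : forall t A, measurable A ->
  distribution P (X k t) A = normal_prob m sigma A.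
Hypothesis indX : mutually_independent P (fun t => X k t : Omega -> R).

Let Z t w : R := (X k t w - m) / sigma.

Let measurable_Z t : measurable_fun setT (Z t).
Proof. by apply: measurable_funM => //; exact: measurable_funB. Qed.

Let measurable_sumZ s a b :
  measurable_fun setT (fun w => \sum_(t < s) (a * Z t w + b * Z t w ^+ 2)).
Proof.
apply: measurable_sum => t; apply: measurable_funD.
  exact: measurable_funM.
by apply: measurable_funM => //; exact: measurable_funX.
Qed.

Lemma expectation_expR_quadratic s a b : b < 2^-1 ->
  (\int[P]_w (expR (\sum_(t < s) (a * Z t w + b * Z t w ^+ 2)))%:E =
   (((Num.sqrt (1 - 2 * b))^-1 * expR (a ^+ 2 / (2 * (1 - 2 * b)))) ^+ s)%:E)%E.
Proof.
move=> b2; pose g (x : R) := expR (a * ((x - m) / sigma) + b * ((x - m) / sigma) ^+ 2).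
have mg : measurable_fun setT g.
  have mu : measurable_fun setT (fun x : R => (x - m) / sigma).
    by apply: measurable_funM => //; exact: measurable_funB.
  exact: (measurableT_comp (measurable_expR_quadratic a b) mu).
have := @independent_expectation_prod _ _ _ _ _ (X k) indX (fun=> g)
  (fun=> (Num.sqrt (1 - 2 * b))^-1 * expR (a ^+ 2 / (2 * (1 - 2 * b))))
  (fun=> mg) (fun _ _ => expR_ge0 _) _ (iota 0 s) (iota_uniq _ _).
rewrite big_const_seq count_predT size_iota iter_mulr_1 => <-; last first.
  by move=> t; rewrite -(normal_expR_quadratic (normalX t) a sigma_gt0 b2).
apply: eq_integral => w _; congr EFin.
by rewrite expR_sum -(big_mkord xpredT (fun t => g (X k t w))) /index_iota subn0.
Qed.

Lemma measurable_sample_mean s : measurable_fun setT (sample_mean X k s).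
Proof. by apply: measurable_funM => //; exact: measurable_sum. Qed.

Lemma measurable_sample_sd s : measurable_fun setT (sample_sd X k s).
Proof.
apply: (measurableT_comp (continuous_measurable_fun (@sqrt_continuous R))).
apply: measurable_funM => //; apply: measurable_sum => t.
by apply: measurable_funX; apply: measurable_funB => //; exact: measurable_sample_mean.
Qed.

Let sample_meanE s w : (0 < s)%N ->
  sample_mean X k s w = m + sigma * ((\sum_(t < s) Z t w) / s%:R).
Proof.
move=> s0; have s0R : s%:R != 0 :> R by rewrite pnatr_eq0 -lt0n.
have -> : \sum_(t < s) Z t w = (\sum_(t < s) X k t w - m * s%:R) / sigma.
  rewrite /Z -mulr_suml sumrB; congr ((_ - _) / _).
  by rewrite sumr_const card_ord mulr_natr.
by rewrite /sample_mean; field; rewrite s0R gt_eqF.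
Qed.

Let sample_sdE s w : (0 < s)%N ->
  sample_sd X k s w ^+ 2 = sigma ^+ 2 *
    ((\sum_(t < s) Z t w ^+ 2) / s%:R - ((\sum_(t < s) Z t w) / s%:R) ^+ 2).
Proof.
move=> s0; have s0R : s%:R != 0 :> R by rewrite pnatr_eq0 -lt0n.
rewrite /sample_sd sqr_sqrtr; last first.
  by rewrite mulr_ge0 ?invr_ge0// sumr_ge0// => t _; exact: sqr_ge0.
rewrite sample_meanE//; set S := \sum_(t < s) Z t w; set V := \sum_(t < s) _ ^+ 2.
transitivity ((\sum_(t < s) sigma ^+ 2 *
    (Z t w ^+ 2 - 2 * (S / s%:R) * Z t w + (S / s%:R) ^+ 2)) / s%:R).
  congr (_ / _); apply: eq_bigr => t _.
  by rewrite /Z; move: (S / s%:R) => q; field; rewrite gt_eqF.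
rewrite -mulr_sumr big_split sumrB /= -mulr_sumr sumr_const card_ord -/S -/V.
by rewrite -[X in _ + X]mulr_natr; field.
Qed.

(** Chernoff bound; the tilt [y / sigma] minimises [t ^+ 2 / 2 - t * (y / sigma)] over [t]. *)
Lemma sample_mean_tail s y : (0 < s)%N -> 0 <= y ->
  (P [set w | (m + y <= sample_mean X k s w)%R] <=
   (expR (- (s%:R * (y / sigma) ^+ 2 / 2)))%:E)%E.
Proof.
move=> s0 y0; set x := y / sigma.
have s0R : 0 < s%:R :> R by rewrite ltr0n.
have x0 : 0 <= x by rewrite divr_ge0// ltW.
pose g w := expR (- (s%:R * x ^+ 2)) *
  expR (\sum_(t < s) (x * Z t w + 0 * Z t w ^+ 2)).
have mg : measurable_fun setT (fun w => expR (\sum_(t < s) (x * Z t w + 0 * Z t w ^+ 2))).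
  by apply: measurableT_comp => //; exact: measurable_sumZ.
have -> : (expR (- (s%:R * x ^+ 2 / 2)))%:E = (\int[P]_w (g w)%:E)%E.
  rewrite /g; under eq_integral do rewrite EFinM.
  rewrite ge0_integralZl//; last exact/measurable_EFinP.
  rewrite expectation_expR_quadratic; last by lra.
  rewrite mulr0 subr0 mulr1 sqrtr1 invr1 mul1r -expRM_natl -EFinM -expRD.
  by congr (expR _)%:E; rewrite -mulr_natl; lra.
apply: prob_le_integral.
- rewrite -[X in measurable X]setTI; apply: measurable_fun_le => //.
  exact: measurable_sample_mean.
- exact: measurable_funM.
- by move=> w; rewrite mulr_ge0 ?expR_ge0.
move=> w /=; rewrite sample_meanE// lerD2l => yS.
rewrite /g -expRD -[leLHS]expR0 ler_expR.
under eq_bigr do rewrite mul0r addr0.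
rewrite -mulr_sumr addrC subr_ge0 expr2 mulrCA ler_wpM2l//.
have : x <= (\sum_(t < s) Z t w) / s%:R by rewrite /x ler_pdivrMr// mulrC.
by rewrite ler_pdivlMr// mulrC.
Qed.

(** Dropping the squared mean bounds the sample variance by [sigma ^+ 2 / s] times a chi-square
    variable with [s] degrees of freedom. The Chernoff tilt [b] is the optimal one, given by
    [1 - 2 * b = (1 + e) ^- 2]. *)
Lemma sample_sd_tail s e : (0 < s)%N -> 0 < e ->
  (P [set w | ((1 + e) * sigma <= sample_sd X k s w)%R] <=
   (((1 + e) * expR (- (((1 + e) ^+ 2 - 1) / 2))) ^+ s)%:E)%E.
Proof.
move=> s0 e0; have s0R : 0 < s%:R :> R by rewrite ltr0n.
have e1 : 0 < 1 + e by lra.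
have e2 : 0 < (1 + e) ^+ 2 by rewrite exprn_gt0.
pose b := (1 - (1 + e) ^- 2) / 2.
have b2 : b < 2^-1.
  have : 0 < (1 + e) ^- 2 by rewrite invr_gt0.
  by rewrite /b; lra.
have b0 : 0 <= b.
  have : (1 + e) ^- 2 <= 1 by rewrite invf_le1 ?exprn_ege1 ?lerDl ?ltW.
  by rewrite /b; lra.
have bE : 1 - 2 * b = (1 + e) ^- 2 by rewrite /b; field; rewrite gt_eqF.
pose g w := expR (- (s%:R * (((1 + e) ^+ 2 - 1) / 2))) *
  expR (\sum_(t < s) (0 * Z t w + b * Z t w ^+ 2)).
have mg : measurable_fun setT (fun w => expR (\sum_(t < s) (0 * Z t w + b * Z t w ^+ 2))).
  by apply: measurableT_comp => //; exact: measurable_sumZ.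
have -> : (((1 + e) * expR (- (((1 + e) ^+ 2 - 1) / 2))) ^+ s)%:E = (\int[P]_w (g w)%:E)%E.
  rewrite /g; under eq_integral do rewrite EFinM.
  rewrite ge0_integralZl//; last exact/measurable_EFinP.
  rewrite expectation_expR_quadratic// bE expr0n mul0r expR0 mulr1 -EFinM.
  rewrite sqrtrV ?exprn_ge0 ?ltW// sqrtr_sqr gtr0_norm// invrK.
  by rewrite exprMn -expRM_natl mulrN mulrC.
apply: prob_le_integral.
- rewrite -[X in measurable X]setTI; apply: measurable_fun_le => //.
  exact: measurable_sample_sd.
- exact: measurable_funM.
- by move=> w; rewrite mulr_ge0 ?expR_ge0.
move=> w /= esd.
have : ((1 + e) * sigma) ^+ 2 <= sample_sd X k s w ^+ 2.
  by rewrite ler_pXn2r ?nnegrE ?sqrtr_ge0// mulr_ge0// ltW.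
rewrite sample_sdE// exprMn mulrC ler_pM2l ?exprn_gt0//.
set V := \sum_(t < s) _; set q := _ / _ => eV.
have {}eV : (1 + e) ^+ 2 * s%:R <= V.
  by rewrite -ler_pdivlMr//; apply: le_trans eV _; rewrite lerBlDr lerDl sqr_ge0.
rewrite /g -expRD -[leLHS]expR0 ler_expR.
under eq_bigr do rewrite mul0r add0r.
rewrite -mulr_sumr -/V addrC subr_ge0.
apply: (@le_trans _ _ (b * ((1 + e) ^+ 2 * s%:R))); last exact: ler_wpM2l.
by rewrite le_eqVlt; apply/orP; left; apply/eqP; rewrite /b; field; rewrite gt_eqF.
Qed.

(* Hubbard-Stratonovich: [exp(h^2 S^2 / 2)] is the Gaussian average of
   [exp(h g S)], so the square of the sum is replaced by a linear statistic. *)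
Lemma expectation_expR_square_sum s h c : 0 <= c -> s%:R * h ^+ 2 < 1 + 2 * c ->
  (\int[P]_w (expR (h ^+ 2 * (\sum_(t < s) Z t w) ^+ 2 / 2
                  - c * \sum_(t < s) Z t w ^+ 2))%:E =
   ((Num.sqrt (1 + 2 * c))^-1 ^+ s *
    (Num.sqrt (1 - s%:R * h ^+ 2 / (1 + 2 * c)))^-1)%:E)%E.
Proof.
move=> c0 hc; have v0 : 0 < 1 + 2 * c by lra.
pose F (p : Omega * measurableTypeR R) : \bar R :=
  (normal_pdf 0 1 p.2 *
   expR (\sum_(t < s) (h * p.2 * Z t p.1 + (- c) * Z t p.1 ^+ 2)))%:E.
have mpdf a b : measurable_fun setT
    (fun g : measurableTypeR R => (normal_pdf 0 1 g * expR (a * g + b * g ^+ 2))%:E).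
  apply/measurable_EFinP; apply: measurable_funM.
    exact: measurable_normal_pdf.
  exact: measurable_expR_quadratic.
have mF : measurable_fun setT F.
  apply/measurable_EFinP; apply: measurable_funM.
    by apply: measurableT_comp; [exact: measurable_normal_pdf|exact: measurable_snd].
  apply: measurableT_comp => //; apply: measurable_sum => t.
  have mZ1 : measurable_fun setT (fun p : Omega * measurableTypeR R => Z t p.1).
    by apply: (measurableT_comp (measurable_Z t)); exact: measurable_fst.
  apply: measurable_funD; apply: measurable_funM => //.
    by apply: measurable_funM => //; exact: measurable_snd.
  exact: measurable_funX.
have F0 p : (0 <= F p)%E by rewrite lee_fin mulr_ge0 ?normal_pdf_ge0 ?expR_ge0.
transitivity (\int[P]_w \int[lebesgue_measure]_g F (w, g))%E.
  apply: eq_integral => w _; rewrite /F /=.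
  set S := \sum_(t < s) Z t w; set V := \sum_(t < s) _.
  transitivity (\int[lebesgue_measure]_g ((expR (- (c * V)))%:E *
    (normal_pdf 0 1 g * expR (h * S * g + 0 * g ^+ 2))%:E))%E.
    rewrite ge0_integralZl//; last first.
      by move=> g _; rewrite lee_fin mulr_ge0 ?normal_pdf_ge0 ?expR_ge0.
    rewrite std_normal_expR_quadratic; last by lra.
    rewrite mulr0 subr0 mulr1 sqrtr1 invr1 mul1r.
    by rewrite -EFinM -expRD exprMn addrC.
  apply: eq_integral => g _; rewrite -EFinM mulrCA; congr (_ * _)%:E.
  rewrite -expRD; congr expR.
  by rewrite big_split /= -!mulr_sumr -/S -/V; ring.
rewrite (@fubini_tonelli _ _ _ _ _ P lebesgue_measure F)//.
pose r := (Num.sqrt (1 + 2 * c))^-1.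
have hv : s%:R * h ^+ 2 / (1 + 2 * c) < 1 by rewrite ltr_pdivrMr// mul1r.
transitivity (\int[lebesgue_measure]_g ((r ^+ s)%:E *
  (normal_pdf 0 1 g * expR (0 * g + (s%:R * h ^+ 2 / (1 + 2 * c) / 2) * g ^+ 2))%:E))%E.
  apply: eq_integral => g _; rewrite /F /=; under eq_integral do rewrite EFinM.
  rewrite ge0_integralZl//; last 2 first.
  - by apply/measurable_EFinP; apply: measurableT_comp => //; exact: measurable_sumZ.
  - by rewrite lee_fin normal_pdf_ge0.
  rewrite expectation_expR_quadratic; last by lra.
  rewrite -!EFinM mulrCA; congr (_ * _)%:E; rewrite mulrN opprK.
  rewrite exprMn -/r -expRM_natl; congr (_ * expR _).
  by rewrite mul0r add0r; field; rewrite gt_eqF.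
rewrite ge0_integralZl//; last 2 first.
- by move=> g _; rewrite lee_fin mulr_ge0 ?normal_pdf_ge0 ?expR_ge0.
- by rewrite lee_fin exprn_ge0// invr_ge0 sqrtr_ge0.
rewrite std_normal_expR_quadratic//; last by lra.
rewrite expr0n mul0r expR0 mulr1 -EFinM; congr (_ * (Num.sqrt _)^-1)%:E.
by field; rewrite gt_eqF.
Qed.

(* The factor [exp(- (s - 1) y^2 / (2 sigma^2))] gained from the margin [y]
   makes the bound summable over [s]; without it the union bound over [s] would
   cost a factor polynomial in [log n]. *)
Lemma sample_bound_tail s z y : (1 < s)%N -> 0 <= z -> 0 <= y ->
  (P [set w | (sample_mean X k s w + sample_sd X k s w * z <= m - y)%R] <=
   (s%:R * expR 1 * (Num.sqrt (1 + z ^+ 2))^-1 ^+ s.-1 *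
    expR (- (s.-1%:R * (y / sigma) ^+ 2 / 2)))%:E)%E.
Proof.
move=> s1 z0 y0; have s0 : (0 < s)%N by exact: ltnW.
have s0R : 0 < s%:R :> R by rewrite ltr0n.
set n1 : R := s.-1%:R.
have sE : s%:R = n1 + 1 :> R by rewrite natr1 prednK.
have n10 : 0 < n1 by rewrite ltr0n -subn1 subn_gt0.
(* On the event, [(1 + z^2) (S/s)^2 - z^2 V/s - (y/sigma)^2 >= 0], where [S] and [V] are the sums of
   the [Z t] and of their squares. Multiplying by [(s - 1) / 2] gives the exponent, with [h ^+ 2]
   and [c] as the coefficients. With [kap = 1] the expectation would diverge; this [kap] gives the
   second factor the value [Num.sqrt (s (1 + 2 c))]. *)
pose kap := n1 / s%:R.
have kap0 : 0 < kap by rewrite divr_gt0.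
have kap1 : kap <= 1 by rewrite ler_pdivrMr// mul1r sE lerDl.
have z2 : 0 <= z ^+ 2 by exact: sqr_ge0.
pose c := kap * z ^+ 2 / 2.
have c0 : 0 <= c by rewrite !mulr_ge0// ltW.
pose h := Num.sqrt (kap * (1 + z ^+ 2) / s%:R).
have hE : h ^+ 2 = kap * (1 + z ^+ 2) / s%:R.
  by rewrite sqr_sqrtr// !mulr_ge0 ?invr_ge0 ?ltW//; lra.
have v0 : 0 < 1 + 2 * c by lra.
have hv : 1 - s%:R * h ^+ 2 / (1 + 2 * c) = (s%:R * (1 + 2 * c))^-1.
  rewrite hE /c /kap sE; field.
  have := mulr_ge0 (ltW n10) z2.
  by move=> nz; rewrite !gt_eqF//; lra.
have hlt : s%:R * h ^+ 2 < 1 + 2 * c.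
  rewrite -subr_gt0 -(pmulr_lgt0 _ (x := (1 + 2 * c)^-1)) ?invr_gt0//.
  by rewrite mulrBl divff ?gt_eqF// hv invr_gt0 mulr_gt0.
pose D w := h ^+ 2 * (\sum_(t < s) Z t w) ^+ 2 / 2 - c * \sum_(t < s) Z t w ^+ 2.
have mD : measurable_fun setT (fun w => expR (D w)).
  apply: measurableT_comp => //; apply: measurable_funB.
    apply: measurable_funM => //; apply: measurable_funM => //.
    by apply: measurable_funX; exact: measurable_sum.
  by apply: measurable_funM => //; apply: measurable_sum => t; exact: measurable_funX.
pose g w := expR (- (n1 * (y / sigma) ^+ 2 / 2)) * expR (D w).
apply: (@le_trans _ _ (\int[P]_w (g w)%:E)%E).
  apply: prob_le_integral.
  - rewrite -[X in measurable X]setTI; apply: measurable_fun_le => //.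
    apply: measurable_funD; first exact: measurable_sample_mean.
    by apply: measurable_funM => //; exact: measurable_sample_sd.
  - exact: measurable_funM.
  - by move=> w; rewrite mulr_ge0 ?expR_ge0.
  move=> w /= bound; rewrite /g -expRD -[leLHS]expR0 ler_expR.
  have sd0 : 0 <= sample_sd X k s w by exact: sqrtr_ge0.
  have sdE := sample_sdE w s0; rewrite sample_meanE// in bound.
  rewrite /D; move: sdE bound.
  set S := \sum_(t < s) Z t w; set V := \sum_(t < s) _.
  set q := sample_sd X k s w in sd0 * => sdE bound.
  have {bound} : (y / sigma + q * z / sigma) ^+ 2 <= (S / s%:R) ^+ 2.
    rewrite -(sqrrN (S / _)) ler_pXn2r ?nnegrE//.
    - rewrite -mulrDl ler_pdivrMr//; lra.
    - by rewrite addr_ge0// !mulr_ge0 ?invr_ge0// ltW.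
    - apply: (@le_trans _ _ ((y + q * z) / sigma)).
        by rewrite !(mulr_ge0, addr_ge0)// invr_ge0 ltW.
      by rewrite ler_pdivrMr//; lra.
  move=> bound.
  (* Expanding the square, the cross term is nonnegative and is dropped; the sample variance is then
     written through [S] and [V]. *)
  have {}bound : (y / sigma) ^+ 2 + z ^+ 2 * (V / s%:R - (S / s%:R) ^+ 2) <= (S / s%:R) ^+ 2.
    apply: le_trans bound.
    have -> : z ^+ 2 * (V / s%:R - (S / s%:R) ^+ 2) = (q * z / sigma) ^+ 2.
      rewrite (_ : (q * z / sigma) ^+ 2 = q ^+ 2 * z ^+ 2 / sigma ^+ 2).
        by rewrite sdE; field; rewrite !gt_eqF.
      by rewrite -exprMn expr_div_n.
    rewrite sqrrD addrAC lerDl mulrn_wge0// !mulr_ge0 ?invr_ge0// ltW//.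
  have -> : - (n1 * (y / sigma) ^+ 2 / 2) + (h ^+ 2 * S ^+ 2 / 2 - c * V) =
      n1 / 2 * ((S / s%:R) ^+ 2 - ((y / sigma) ^+ 2 + z ^+ 2 * (V / s%:R - (S / s%:R) ^+ 2))).
    rewrite hE /c /kap; move: (y / sigma) => r.
    by field; rewrite gt_eqF.
  by rewrite mulr_ge0 ?subr_ge0// ltW// divr_gt0.
rewrite /g; under eq_integral do rewrite EFinM.
rewrite ge0_integralZl//; last exact/measurable_EFinP.
rewrite expectation_expR_square_sum// -EFinM lee_fin mulrC.
apply: ler_wpM2r; first exact: expR_ge0.
rewrite hv sqrtrV ?mulr_ge0 ?(ltW s0R) ?(ltW v0)// invrK sqrtrM ?(ltW s0R)//.
set rv := Num.sqrt (1 + 2 * c).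
have rv0 : 0 < rv by rewrite sqrtr_gt0.
have -> : rv^-1 ^+ s = rv^-1 ^+ s.-1 * rv^-1 by rewrite -exprSr prednK.
have -> : rv^-1 ^+ s.-1 * rv^-1 * (Num.sqrt s%:R * rv) = Num.sqrt s%:R * rv^-1 ^+ s.-1.
  by move: (rv^-1 ^+ _) => r; field; rewrite gt_eqF.
rewrite -[leRHS]mulrA; apply: ler_pM.
- exact: sqrtr_ge0.
- by rewrite exprn_ge0// invr_ge0 ltW.
- rewrite -[leRHS]ger0_norm ?(ltW s0R)// -sqrtr_sqr ler_wsqrtr// expr2.
  by rewrite ler_peMl ?(ltW s0R)// ler1n.
have rz0 : 0 < Num.sqrt (1 + z ^+ 2) by rewrite sqrtr_gt0; lra.
(* Replacing [1 + kap z^2] by [kap^2 (1 + z^2)] costs [kap^-1] per factor, in total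
   [(1 + 1/n1)^n1 <= e]; this is the [expR 1] of the statement. *)
have kinv : kap^-1 <= expR n1^-1.
  apply: le_trans (expR_ge1Dx _); rewrite /kap invf_div sE.
  by rewrite mulrDl divff ?gt_eqF// mul1r.
have rvz : rv^-1 <= kap^-1 * (Num.sqrt (1 + z ^+ 2))^-1.
  rewrite -invfM lef_pV2 ?posrE ?mulr_gt0 ?invr_gt0//.
  rewrite -[X in X * _]gtr0_norm// -sqrtr_sqr -sqrtrM ?sqr_ge0//.
  rewrite ler_wsqrtr// /c mulrDr mulr1.
  have kk : kap ^+ 2 <= kap by rewrite expr2 ler_piMl// ltW.
  have := ler_wpM2r z2 kk; lra.
apply: (@le_trans _ _ ((kap^-1 * (Num.sqrt (1 + z ^+ 2))^-1) ^+ s.-1)).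
  by rewrite lerXn2r ?nnegrE ?mulr_ge0 ?invr_ge0 ?(ltW rv0) ?(ltW rz0) ?(ltW kap0).
rewrite exprMn ler_wpM2r ?exprn_ge0 ?invr_ge0 ?(ltW rz0)//.
apply: (@le_trans _ _ (expR n1^-1 ^+ s.-1)).
  by rewrite lerXn2r ?nnegrE ?invr_ge0 ?expR_ge0 ?(ltW kap0).
by rewrite -expRM_natl mulfV ?gt_eqF.
Qed.

End normal_sample.

(** * The number of draws of a suboptimal arm *)

Section M_bounds.
Context (R : realType).
Implicit Types z t : R.

Lemma M_gt0 z : 0 < z -> 0 < M z.
Proof. by move=> z0; rewrite /M mulr_gt0// ln_gt0// ltrDl exprn_gt0. Qed.

Lemma M_le_sqr z : M z <= z ^+ 2 / 2.
Proof.
rewrite /M mulrC ler_pM2r// le_ln1Dx//.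
by rewrite (lt_le_trans _ (sqr_ge0 z))// oppr_lt0.
Qed.

Lemma ler_M z z' : 0 <= z <= z' -> M z <= M z'.
Proof.
move=> /andP[z0 zz']; rewrite /M ler_pM2l// ler_ln ?posrE.
- by rewrite lerD2l lerXn2r ?nnegrE// (le_trans z0).
- by rewrite ltr_wpDr ?sqr_ge0.
- by rewrite ltr_wpDr ?sqr_ge0.
Qed.

(* Concavity of [ln] between [1] and [1 + z^2]. *)
Lemma M_scale t z : 0 <= t <= 1 -> t ^+ 2 * M z <= M (t * z).
Proof.
move=> /andP[t0 t1]; rewrite /M mulrCA ler_pM2l//.
have t2 : 0 <= t ^+ 2 <= 1 by rewrite sqr_ge0 exprn_ile1.
have zp : 0 < 1 + z ^+ 2 by rewrite ltr_wpDr ?sqr_ge0.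
have tp : 0 < 1 + (t * z) ^+ 2 by rewrite ltr_wpDr ?sqr_ge0.
pose i : {i01 R} := @Itv01 R (t ^+ 2) (andP t2).1 (andP t2).2.
have := concave_ln i zp ltr01.
rewrite !convRE /= ln1 mulr0 addr0 => /le_trans; apply.
by rewrite exprMn /unstable.onem le_eqVlt; apply/orP; left; apply/eqP; congr ln; ring.
Qed.

End M_bounds.

Lemma mean_le_best (R : realType) (K : nat) (theta : param R K) k :
  mean theta k <= best_mean theta.
Proof.
apply: ub_le_sup; last by exists k.
exists (\sum_(i < K) `|mean theta i|) => _ [i _ <-].
by rewrite (bigD1 i)//= (le_trans (ler_norm _))// lerDl sumr_ge0.
Qed.

Lemma best_mean_attained (R : realType) (K : nat) (theta : param R K) : (0 < K)%N ->
  exists k, mean theta k = best_mean theta.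
Proof.
case: K theta => // K' theta _.
pose k := [arg max_(i > ord0) mean theta i]%O.
exists k; apply/le_anti/andP; split; first exact: mean_le_best.
apply: ge_sup; first by exists (mean theta k), k.
by move=> _ [i _ <-]; rewrite /k; case: arg_maxP => // j _; apply.
Qed.

Lemma gap_ge0 (R : realType) (K : nat) (theta : param R K) k : 0 <= gap theta k.
Proof. by rewrite /gap subr_ge0 mean_le_best. Qed.

Lemma suboptimalE (R : realType) (K : nat) (theta : param R K) k :
  suboptimal theta k = (0 < gap theta k).
Proof. by rewrite /gap subr_gt0. Qed.

(** * From draw counts to expected regret *)

Section regret_bound.
Context (R : realType) (d : measure_display) (Omega : measurableType d).
Variables (K N : nat) (P : param R K -> probability Omega R).
Variables (X : 'I_K -> nat -> {mfun Omega >-> R}) (pull : nat -> Omega -> 'I_K).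
Variables (lev : nat -> R) (theta : param R K) (kstar : 'I_K).
Hypothesis algo : ucb_large X pull lev N.
Variables (eps D L : R).
Hypothesis eps_bounds : 0 < eps < 2^-1.
Hypothesis sd_gt0 : forall k, 0 < sd theta k.
Hypothesis gap_ge : forall k, suboptimal theta k -> D <= gap theta k.
Hypothesis L_ge0 : 0 <= L.
Hypothesis lev_bounds : forall n, (2 * K <= n < N)%N -> 0 <= lev n <= L.

Let width n s : R := Num.sqrt (expR (2 * lev n / (s%:R - 1)) - 1).

Definition overestimated k s : set Omega :=
  [set w | mean theta k + eps * gap theta k <= sample_mean X k s w] `|`
  [set w | (1 + eps) * sd theta k <= sample_sd X k s w].

Definition best_underestimated n s : set Omega :=
  [set w | sample_mean X kstar s w + sample_sd X kstar s w * width n s <=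
           best_mean theta - eps * D].

(** The gap loses [eps * gap] to the sample mean of arm [k] and [eps * D], at most [eps * gap], to
    the bound of the best arm; the sample standard deviation contributes the factor [1 + eps]. *)
Definition shrunk_ratio k : R := (1 - 2 * eps) / (1 + eps) * (gap theta k / sd theta k).

Lemma npullsS k n w : npulls pull k n.+1 w = (npulls pull k n w + (pull n w == k))%N.
Proof. by rewrite /npulls big_ord_recr. Qed.

Lemma npulls_ge2 k n w : (2 * K <= n)%N -> (2 <= npulls pull k n w)%N.
Proof.
case: algo => _ init _; move=> /subnKC <-; elim: (n - _)%N => [|i IH].
  by rewrite addn0 init.
by rewrite addnS npullsS (leq_trans IH)// leq_addr.
Qed.

Lemma npulls_le k n w : (npulls pull k n w <= n)%N.
Proof.
elim: n => [|n IH]; first by rewrite /npulls big_ord0.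
by rewrite npullsS -addn1 leq_add// leq_b1.
Qed.

Let shrunk_gt0 k : suboptimal theta k -> 0 < shrunk_ratio k.
Proof.
case/andP: eps_bounds => e0 e1; rewrite suboptimalE => g0.
by rewrite /shrunk_ratio mulr_gt0 ?divr_gt0//; lra.
Qed.

Lemma pull_suboptimal k n w : suboptimal theta k -> (2 * K <= n < N)%N ->
  pull n w = k ->
  [\/ (npulls pull k n w)%:R - 1 < L / M (shrunk_ratio k),
      overestimated k (npulls pull k n w) w
    | best_underestimated n (npulls pull kstar n w) w].
Proof.
move=> subk nN pk; case/andP: eps_bounds => e0 e1.
have [] := pselect (overestimated k (npulls pull k n w) w); first by constructor 2.
have [] := pselect (best_underestimated n (npulls pull kstar n w) w).
  by constructor 3.
move=> /negP; rewrite -ltNge => good /not_orP[/negP + /negP].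
rewrite -!ltNge => mean_lt sd_lt; constructor 1.
case: algo => _ _ /(_ n w nN kstar); rewrite pk /conf_bound -/(width _ _) => ucb.
move: mean_lt sd_lt ucb good; rewrite -/(width n (npulls pull k n w)).
have := npulls_ge2 k w (andP nN).1.
set s := npulls pull k n w => s2 mean_lt sd_lt ucb good.
have s1 : 0 < s%:R - 1 :> R by rewrite subr_gt0 ltr1n.
have g0 : 0 < gap theta k by rewrite -suboptimalE.
have [lev0 levL] := andP (lev_bounds nN).
have z0 := shrunk_gt0 subk.
have wd0 : 0 <= width n s by exact: sqrtr_ge0.
have zw : shrunk_ratio k < width n s.
  have geD : eps * D <= eps * gap theta k by rewrite ler_pM2l ?gap_ge.
  have : sample_sd X k s w * width n s <= (1 + eps) * sd theta k * width n s.
    by rewrite ler_wpM2r// ltW.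
  have : best_mean theta = mean theta k + gap theta k by rewrite /gap; ring.
  rewrite /shrunk_ratio mulrACA -invfM ltr_pdivrMr; last first.
    by rewrite mulr_gt0//; lra.
  by rewrite (mulrC (width _ _)); lra.
have : M (shrunk_ratio k) < lev n / (s%:R - 1).
  have E : expR (2 * lev n / (s%:R - 1)) = 1 + width n s ^+ 2.
    rewrite sqr_sqrtr; first by ring.
    by rewrite subr_ge0 -[leLHS]expR0 ler_expR !mulr_ge0// invr_ge0 ltW.
  (* The width is the inverse of [M] at [lev n / (s - 1)], so a lower bound on the width is an upper
     bound on [s - 1]. *)
  have -> : lev n / (s%:R - 1) = M (width n s).
    by rewrite /M -E expRK; field; rewrite gt_eqF.
  rewrite /M ltr_pM2l// ltr_ln ?posrE; last 2 first.
  - by rewrite ltr_wpDr// sqr_ge0.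
  - by rewrite ltr_wpDr// sqr_ge0.
  by rewrite ltrD2l ltr_pXn2r// nnegrE ltW.
rewrite ltr_pdivlMr// ltr_pdivlMr ?M_gt0// mulrC => /lt_le_trans; exact.
Qed.

(** Induction over time, each draw of [k] being charged to one alternative of [pull_suboptimal]. In
    the first, the count after the draw is below [L / M (shrunk_ratio k) + 2] outright. In the
    second, the count [s] before the draw is new and its indicator pays. In the third, an event at
    time [i] pays. The factor [pull i w == k] is kept for the later sum over arms. *)
Lemma npulls_bound w k n : suboptimal theta k -> (2 * K <= n <= N)%N ->
  (npulls pull k n w)%:R <= L / M (shrunk_ratio k) + 2 +
    \sum_(2 <= s < npulls pull k n w) \1_(overestimated k s) w +
    \sum_(2 * K <= i < n) (pull i w == k)%:R *
      \sum_(2 <= s < i.+1) \1_(best_underestimated i s) w.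
Proof.
move=> subk /andP[Kn nN].
have L0 : 0 <= L / M (shrunk_ratio k).
  by rewrite divr_ge0// ltW// M_gt0// shrunk_gt0.
move: nN; rewrite -(subnKC Kn); elim: (n - 2 * K)%N => [|i IH].
  by case: algo => _ init _; rewrite addn0 init !big_geq// !addr0; lra.
rewrite addnS => iN; have := IH (ltnW iN); set j := (2 * K + i)%N in iN *.
have Kj : (2 * K <= j)%N by exact: leq_addr.
rewrite npullsS big_nat_recr//=.
set A := \sum_(2 * K <= _ < _) _; set s := npulls pull k j w.
have [pk|] := eqVneq (pull j w) k; last by rewrite addn0 mul0r addr0.
have s2 : (2 <= s)%N by exact: npulls_ge2.
rewrite addn1 big_nat_recr//= -natr1 mul1r.
set O := \sum_(2 <= _ < _) _ => IHs.
have O0 : 0 <= O by rewrite sumr_ge0.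
have A0 : 0 <= A.
  by rewrite sumr_ge0// => a _; rewrite mulr_ge0// sumr_ge0.
have B0 : 0 <= \sum_(2 <= s0 < j.+1) \1_(best_underestimated j s0) w :> R.
  by rewrite sumr_ge0.
have o0 : 0 <= \1_(overestimated k s) w :> R by [].
have jN : (2 * K <= j < N)%N by rewrite Kj.
have [||] := pull_suboptimal subk jN pk.
- by rewrite -/s; lra.
- rewrite -/s => ov; have -> : \1_(overestimated k s) w = 1 :> R.
    by rewrite indicE mem_set.
  lra.
- move=> bu; have : 1 <= \sum_(2 <= s0 < j.+1) \1_(best_underestimated j s0) w :> R.
    (* The random count of the best arm lies between [2] and [j], so one term of the sum is the
       indicator that holds. *)
    rewrite (bigD1_seq (npulls pull kstar j w))/= ?iota_uniq//; last first.
      by rewrite mem_index_iota npulls_ge2// ltnS npulls_le.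
    by rewrite indicE mem_set// lerDl sumr_ge0.
  lra.
Qed.

Hypothesis twoK_le : (2 * K <= N)%N.
Variables (G : R) (pO : 'I_K -> nat -> R) (pB : nat -> nat -> R).
Hypothesis gap_le : forall k, gap theta k <= G.
Hypothesis prob_over : forall k s, (1 < s)%N ->
  (P theta (overestimated k s) <= (pO k s)%:E)%E.
Hypothesis prob_under : forall n s, (2 * K <= n < N)%N -> (1 < s)%N ->
  (P theta (best_underestimated n s) <= (pB n s)%:E)%E.

Lemma measurable_overestimated k s : measurable (overestimated k s).
Proof.
apply: measurableU; rewrite -[X in measurable X]setTI; apply: measurable_fun_le => //.
  exact: measurable_sample_mean.
exact: measurable_sample_sd.
Qed.

Lemma measurable_best_underestimated n s : measurable (best_underestimated n s).
Proof.
rewrite -[X in measurable X]setTI; apply: measurable_fun_le => //.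
apply: measurable_funD; first exact: measurable_sample_mean.
by apply: measurable_funM => //; exact: measurable_sample_sd.
Qed.

Lemma measurable_npulls k n :
  measurable_fun setT (fun w => (npulls pull k n w)%:R : R).
Proof.
case: algo => mpull _ _.
rewrite (_ : (fun w => _) = (fun w => \sum_(i < n) \1_[set w | pull i w = k] w)).
  by apply: measurable_sum => i; exact: measurable_indic.
apply/funext => w; rewrite /npulls natr_sum; apply: eq_bigr => i _.
by rewrite indicE; case: eqP => pk; [rewrite mem_set|rewrite memNset].
Qed.

(** After exchanging the sums over arms and times, at most one arm contributes at each time, so an
    underestimation costs at most [G] instead of the sum of all gaps. The [+ 1] is the [+ 2] of
    [npulls_bound] less the draw that the regret does not count. *)
Lemma total_gap_bound w :
  \sum_(k < K) gap theta k * Num.max ((npulls pull k N w)%:R - 1) 0 <=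
  \sum_(k < K | suboptimal theta k) gap theta k *
    (L / M (shrunk_ratio k) + 1 + \sum_(2 <= s < N) \1_(overestimated k s) w) +
  \sum_(2 * K <= n < N) G * \sum_(2 <= s < n.+1) \1_(best_underestimated n s) w.
Proof.
have NN : (2 * K <= N <= N)%N by rewrite twoK_le /=.
rewrite (bigID (suboptimal theta))/= [X in _ + X]big1 ?addr0; last first.
  move=> k; rewrite suboptimalE -leNgt => g0.
  by rewrite (_ : gap theta k = 0) ?mul0r//; apply/le_anti; rewrite g0 gap_ge0.
pose Bsum n : R := \sum_(2 <= s < n.+1) \1_(best_underestimated n s) w.
have Bsum0 n : 0 <= Bsum n by rewrite sumr_ge0.
apply: (@le_trans _ _ (\sum_(k < K | suboptimal theta k) (gap theta k *
    (L / M (shrunk_ratio k) + 1 + \sum_(2 <= s < N) \1_(overestimated k s) w) +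
  gap theta k * \sum_(2 * K <= n < N) (pull n w == k)%:R * Bsum n))).
  apply: ler_sum => k subk; rewrite -mulrDr ler_wpM2l ?gap_ge0//.
  have n2 := npulls_ge2 k w twoK_le.
  have n2R : 2 <= (npulls pull k N w)%:R :> R by rewrite (ler_nat _ 2).
  rewrite max_l; last by lra.
  have := npulls_bound w subk NN.
  have : \sum_(2 <= s < npulls pull k N w) \1_(overestimated k s) w <=
         \sum_(2 <= s < N) \1_(overestimated k s) w :> R.
    by rewrite (big_cat_nat n2 (npulls_le k N w))/= lerDl sumr_ge0.
  by rewrite -/(Bsum _); lra.
rewrite big_split/= lerD2l; under eq_bigr do rewrite mulr_sumr.
rewrite exchange_big/=; apply: ler_sum => n _.
under eq_bigr do rewrite mulrA.
rewrite -mulr_suml ler_wpM2r//.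
have [sp|nsp] := boolP (suboptimal theta (pull n w)).
  rewrite (bigD1 (pull n w))//= eqxx mulr1 big1 ?addr0//.
  by move=> k /andP[_]; rewrite eq_sym => /negPf ->; rewrite mulr0.
rewrite big1 ?(le_trans (gap_ge0 theta kstar))//.
by move=> k sk; case: eqP => pk; [move: nsp; rewrite pk sk|rewrite mulr0].
Qed.

(** Closed under sums and nonnegative multiples, so the expectation of the pathwise bound can be
    estimated along its syntax. *)
Let Ele (h : Omega -> R) (c : R) :=
  [/\ measurable_fun setT h, forall w, 0 <= h w &
      (\int[P theta]_w (h w)%:E <= c%:E)%E].

Let Ele_cst c : 0 <= c -> Ele (fun=> c) c.
Proof. by move=> c0; split => //; rewrite -[leRHS](expectation_cst (P theta)) unlock. Qed.

Let Ele_indic A c : measurable A -> (P theta A <= c%:E)%E -> Ele (\1_A) c.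
Proof. by move=> mA Ac; split=> //; rewrite ?integral_indic ?setIT. Qed.

Let EleD h h' c c' : Ele h c -> Ele h' c' -> Ele (fun w => h w + h' w) (c + c').
Proof.
move=> [mh h0 hc] [mh' h0' hc']; split; first exact: measurable_funD.
- by move=> w; rewrite addr_ge0.
- under eq_integral do rewrite EFinD.
  rewrite ge0_integralD//; first by rewrite EFinD leeD.
  all: by [exact/measurable_EFinP|move=> w _; rewrite lee_fin].
Qed.

Let EleZ a h c : 0 <= a -> Ele h c -> Ele (fun w => a * h w) (a * c).
Proof.
move=> a0 [mh h0 hc]; split; first exact: measurable_funM.
- by move=> w; rewrite mulr_ge0.
- under eq_integral do rewrite EFinM.
  rewrite ge0_integralZl//; first by rewrite EFinM lee_wpmul2l// lee_fin.
  all: by [exact/measurable_EFinP|move=> w _; rewrite lee_fin].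
Qed.

Let Ele_sum (I : eqType) (r : seq I) (Q : pred I) (h : I -> Omega -> R) (c : I -> R) :
  (forall i, i \in r -> Q i -> Ele (h i) (c i)) ->
  Ele (fun w => \sum_(i <- r | Q i) h i w) (\sum_(i <- r | Q i) c i).
Proof.
elim: r => [|i r IH] hc.
  rewrite big_nil (_ : (fun w => _) = fun=> 0); first exact: Ele_cst.
  by apply/funext => w; rewrite big_nil.
have {}IH := IH (fun j jr => hc j (mem_behead (s := i :: r) jr)).
rewrite big_cons; have [Qi|nQi] := boolP (Q i); last first.
  by under eq_fun do rewrite big_cons (negPf nQi).
under eq_fun do rewrite big_cons Qi.
by apply: EleD => //; apply: hc; rewrite ?mem_head.
Qed.

Lemma regret_le_tails :
  (regret pull P N theta <=
   (\sum_(k < K | suboptimal theta k) gap theta k *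
      (L / M (shrunk_ratio k) + 1 + \sum_(2 <= s < N) pO k s) +
    \sum_(2 * K <= n < N) G * \sum_(2 <= s < n.+1) pB n s)%:E)%E.
Proof.
have mmax k : measurable_fun setT (fun w => Num.max ((npulls pull k N w)%:R - 1) 0 : R).
  by apply: measurable_maxr => //; apply: measurable_funB => //; exact: measurable_npulls.
have -> : regret pull P N theta = (\int[P theta]_w
    (\sum_(k < K) gap theta k * Num.max ((npulls pull k N w)%:R - 1) 0)%:E)%E.
  rewrite /regret; under [RHS]eq_integral do rewrite -sumEFin.
  rewrite ge0_integral_sum//; last 2 first.
  - by move=> k; apply/measurable_EFinP; exact: measurable_funM.
  - by move=> k w _; rewrite lee_fin mulr_ge0 ?gap_ge0// le_max lexx orbT.
  apply: eq_bigr => k _; under [RHS]eq_integral do rewrite EFinM.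
  rewrite ge0_integralZl ?lee_fin ?gap_ge0//; first by rewrite unlock.
  exact/measurable_EFinP.
have G0 : 0 <= G by exact: le_trans (gap_ge0 theta kstar) (gap_le kstar).
have [mH H0] : Ele (fun w => \sum_(k < K | suboptimal theta k) gap theta k *
    (L / M (shrunk_ratio k) + 1 + \sum_(2 <= s < N) \1_(overestimated k s) w) +
  \sum_(2 * K <= n < N) G * \sum_(2 <= s < n.+1) \1_(best_underestimated n s) w)
  (\sum_(k < K | suboptimal theta k) gap theta k *
      (L / M (shrunk_ratio k) + 1 + \sum_(2 <= s < N) pO k s) +
    \sum_(2 * K <= n < N) G * \sum_(2 <= s < n.+1) pB n s).
  apply: EleD.
    apply: Ele_sum => k _ subk; apply: EleZ; first exact: gap_ge0.
    apply: EleD.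
      by apply: Ele_cst; rewrite addr_ge0// divr_ge0// ltW// M_gt0// shrunk_gt0.
    apply: Ele_sum => s; rewrite mem_index_iota => /andP[s2 _] _.
    by apply: Ele_indic; [exact: measurable_overestimated|exact: prob_over].
  apply: Ele_sum => n; rewrite mem_index_iota => nKN _; apply: EleZ => //.
  apply: Ele_sum => s; rewrite mem_index_iota => /andP[s2 _] _.
  by apply: Ele_indic; [exact: measurable_best_underestimated|exact: prob_under].
apply: le_trans; apply: ge0_le_integral => //.
- move=> w _; rewrite lee_fin sumr_ge0// => k _.
  by rewrite mulr_ge0 ?gap_ge0// le_max lexx orbT.
- by apply/measurable_EFinP; apply: measurable_sum => k; exact: measurable_funM.
- exact/measurable_EFinP.
- by move=> w _; rewrite lee_fin total_gap_bound.
Qed.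

End regret_bound.

(** * The bound for a finite horizon *)

Section series_bounds.
Context (R : realType).

Lemma sum_expr_pred_le (r : R) n : 0 <= r < 1 ->
  \sum_(2 <= s < n) r ^+ s.-1 <= r / (1 - r).
Proof.
move=> /andP[r0 r1]; rewrite ler_pdivlMr ?subr_gt0//.
elim: n => [|n IH]; first by rewrite big_geq// mul0r.
have [n2|n2] := ltnP n 2; first by rewrite big_geq// mul0r.
suff : (\sum_(2 <= s < n.+1) r ^+ s.-1) * (1 - r) = r - r ^+ n.
  by move=> ->; rewrite lerBlDr lerDl exprn_ge0.
elim: n n2 {IH} => // n IH; rewrite leq_eqVlt => /predU1P[<-|n2].
  by rewrite big_nat1 /=; ring.
have -> : \sum_(2 <= s < n.+2) r ^+ s.-1 = \sum_(2 <= s < n.+1) r ^+ s.-1 + r ^+ n.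
  by rewrite big_nat_recr// ltnW.
by rewrite mulrDl IH// exprS; ring.
Qed.

(** The geometric series is at most [1 / (expR x - 1)], and [expR x - 1 >= x]. *)
Lemma sum_expR_pred_le (x : R) n : 0 < x ->
  \sum_(2 <= s < n) expR (- (s.-1%:R * x)) <= x^-1.
Proof.
move=> x0; have r1 : expR (- x) < 1 by rewrite -expR0 ltr_expR oppr_lt0.
rewrite (eq_bigr (fun s => expR (- x) ^+ s.-1)); last first.
  by move=> s _; rewrite -expRM_natl mulrN.
apply: (le_trans (sum_expr_pred_le _ _)); first by rewrite expR_ge0.
rewrite ler_pdivrMr ?subr_gt0// ler_pdivlMl//.
have : expR (- x) * expR x = 1 by rewrite -expRD addNr expR0.
have := expR_gt0 (- x); have := expR_ge1Dx x; nra.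
Qed.

Lemma sum_expR_le (x : R) n : 0 < x ->
  \sum_(2 <= s < n) expR (- (s%:R * x)) <= x^-1.
Proof.
move=> x0; apply: le_trans (sum_expR_pred_le n x0); apply: ler_sum => s _.
by rewrite ler_expR lerN2 ler_wpM2r ?(ltW x0)// ler_nat leq_pred.
Qed.

(** Half of the exponent absorbs the factor [s], at the price [4 / x]; the other half is summed to
    at most [2 / x]. *)
Lemma sum_natM_expR_pred_le (x : R) n : 0 < x ->
  \sum_(2 <= s < n) s%:R * expR (- (s.-1%:R * x)) <= 8 / x ^+ 2.
Proof.
move=> x0; have x20 : 0 < x / 2 by lra.
apply: (@le_trans _ _ (\sum_(2 <= s < n) 4 / x * expR (- (s.-1%:R * (x / 2))))).
  rewrite big_nat_cond [leRHS]big_nat_cond; apply: ler_sum => -[|[|s]]//= _.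
  set j : R := s.+1%:R.
  have j1 : 1 <= j by rewrite ler1n.
  have -> : s.+2%:R = j + 1 by rewrite natr1.
  have -> : - (j * x) = - (j * (x / 2)) + - (j * (x / 2)) by lra.
  rewrite expRD mulrA ler_wpM2r ?expR_ge0//.
  rewrite ler_pdivlMr//.
  have := expR_ge1Dx (j * (x / 2)); have := expR_gt0 (- (j * (x / 2))).
  have : expR (- (j * (x / 2))) * expR (j * (x / 2)) = 1 by rewrite -expRD addNr expR0.
  move: (expR (- (j * (x / 2)))) (expR (j * (x / 2))) => u v uv u0 v1.
  have uj : u * (1 + j * (x / 2)) <= 1 by rewrite -[leRHS]uv ler_pM2l.
  have : 0 <= u * x * (j - 1) by rewrite !mulr_ge0 ?subr_ge0 ?(ltW u0) ?(ltW x0).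
  lra.
rewrite -mulr_sumr.
apply: (@le_trans _ _ (4 / x * (x / 2)^-1)).
  by rewrite ler_wpM2l ?divr_ge0 ?(ltW x0)// sum_expR_pred_le.
by rewrite le_eqVlt; apply/orP; left; apply/eqP; field; rewrite gt_eqF.
Qed.

End series_bounds.

Lemma ler_expR_margin (R : realType) (e : R) : 0 <= e ->
  (1 + e) * expR (- (((1 + e) ^+ 2 - 1) / 2)) <= expR (- (e ^+ 2 / 2)).
Proof.
move=> e0; rewrite (_ : - (e ^+ 2 / 2) = e + - (((1 + e) ^+ 2 - 1) / 2)); last by field.
by rewrite expRD ler_wpM2r ?expR_ge0// expR_ge1Dx.
Qed.

Lemma arm_independent (R : realType) (d : measure_display) (Omega : measurableType d)
    (P : probability Omega R) (K : nat) (X : 'I_K -> nat -> {mfun Omega >-> R}) k :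
  mutually_independent P (fun i : 'I_K * nat => X i.1 i.2 : Omega -> R) ->
  mutually_independent P (fun t : nat => X k t : Omega -> R).
Proof.
move=> ind s A us mA.
have := ind [seq (k, t) | t <- s] (fun i => A i.2).
rewrite !big_map; apply; first by rewrite map_inj_uniq// => a b [].
by move=> i /mapP[t ts ->]; exact: mA.
Qed.

Section finite_horizon.
Context (R : realType) (d : measure_display) (Omega : measurableType d).
Variables (K N : nat) (P : param R K -> probability Omega R).
Variables (X : 'I_K -> nat -> {mfun Omega >-> R}) (pull : nat -> Omega -> 'I_K).
Variables (lev : nat -> R) (theta : param R K).
Hypothesis K_gt0 : (0 < K)%N.
Hypothesis arms : normal_arms P X.
Hypothesis algo : ucb_large X pull lev N.
Variables (eps D L : R).
Hypothesis eps_bounds : 0 < eps < 2^-1.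
Hypothesis D_gt0 : 0 < D.
Hypothesis in_Theta2 : Theta2 D theta.
Hypothesis L_ge0 : 0 <= L.
Hypothesis lev_bounds : forall n, (2 * K <= n < N)%N -> 0 <= lev n <= L.
Hypothesis twoK_le : (2 * K <= N)%N.

Let sd_bounds k : D <= sd theta k <= D^-1.
Proof. by case: in_Theta2. Qed.

Let sd_gt0 k : 0 < sd theta k.
Proof. by case/andP: (sd_bounds k) => /(lt_le_trans D_gt0). Qed.

Let gap_ge k : suboptimal theta k -> D <= gap theta k.
Proof. by case: in_Theta2 => /(_ k) + _ _ _ => /[apply]; rewrite /gap; lra. Qed.

Let gap_le k : gap theta k <= 2 / D.
Proof.
case: in_Theta2 => _ mean_le _ _.
have [j bj] := best_mean_attained theta K_gt0.
have := mean_le j; have := mean_le k; rewrite /gap -bj !ler_norml; lra.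
Qed.

Let normalX k t A : measurable A ->
  distribution (P theta) (X k t) A = normal_prob (mean theta k) (sd theta k) A.
Proof.
move=> mA; have [|+ _] := arms (theta := theta); last exact.
by move=> j; have := sd_gt0 j; rewrite /sd sqrtr_gt0.
Qed.

Let indX k : mutually_independent (P theta) (fun t : nat => X k t : Omega -> R).
Proof.
apply: arm_independent; have [|_ +] := arms (theta := theta); last exact.
by move=> j; have := sd_gt0 j; rewrite /sd sqrtr_gt0.
Qed.

Let pO k s : R := expR (- (s%:R * ((eps * gap theta k / sd theta k) ^+ 2 / 2))) +
  expR (- (s%:R * (eps ^+ 2 / 2))).

(** The margin [eps * D] divided by a standard deviation of at most [D^-1] is at least
    [eps * D ^+ 2]. *)
Let x0 := (eps * D ^+ 2) ^+ 2 / 2.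

Let pB n s : R :=
  expR 1 * expR (- lev n) * (s%:R * expR (- (s.-1%:R * x0))).

Let prob_over k s : (1 < s)%N ->
  (P theta (overestimated X theta eps k s) <= (pO k s)%:E)%E.
Proof.
case/andP: eps_bounds => e0 _ s1; have s0 : (0 < s)%N by exact: ltnW.
have mA : measurable [set w | (mean theta k + eps * gap theta k <= sample_mean X k s w)%R].
  rewrite -[X in measurable X]setTI; apply: measurable_fun_le => //.
  exact: measurable_sample_mean.
have mB : measurable [set w | ((1 + eps) * sd theta k <= sample_sd X k s w)%R].
  rewrite -[X in measurable X]setTI; apply: measurable_fun_le => //.
  exact: measurable_sample_sd.
apply: (le_trans (measureU2 _ mA mB)); rewrite EFinD; apply: leeD.
  apply: (le_trans (sample_mean_tail (sd_gt0 k) (@normalX k) (indX k) s0 _)).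
    by rewrite mulr_ge0 ?gap_ge0// ltW.
  by rewrite mulrA.
apply: (le_trans (sample_sd_tail (sd_gt0 k) (@normalX k) (indX k) s0 e0)).
rewrite lee_fin -(mulrN s%:R) expRM_natl lerXn2r ?nnegrE ?expR_ge0 ?ler_expR_margin ?(ltW e0)//.
by rewrite mulr_ge0 ?expR_ge0// addr_ge0// ltW.
Qed.

(** For the width used by the algorithm, [Num.sqrt (1 + z ^+ 2)] is [expR (lev n / (s - 1))], whose
    power [-(s - 1)] is [expR (- lev n)] for every [s]. The bound thus splits into a factor in [n]
    and one in [s]. *)
Let prob_under kstar n s : mean theta kstar = best_mean theta ->
  (2 * K <= n < N)%N -> (1 < s)%N ->
  (P theta (best_underestimated X lev theta kstar eps D n s) <= (pB n s)%:E)%E.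
Proof.
move=> kbest nN s1; case/andP: eps_bounds => e0 _.
have [lev0 _] := andP (lev_bounds nN).
have n10 : 0 < s%:R - 1 :> R by rewrite subr_gt0 ltr1n.
have arg0 : 0 <= 2 * lev n / (s%:R - 1) by rewrite !mulr_ge0// invr_ge0 ltW.
rewrite /best_underestimated -kbest.
apply: (le_trans (sample_bound_tail (sd_gt0 kstar) (@normalX kstar) (indX kstar) s1 _ _)).
- exact: sqrtr_ge0.
- by rewrite mulr_ge0// ltW.
rewrite lee_fin sqr_sqrtr; last by rewrite subr_ge0 -[leLHS]expR0 ler_expR.
rewrite subrKC.
have -> : Num.sqrt (expR (2 * lev n / (s%:R - 1))) = expR (lev n / (s%:R - 1)).
  rewrite (_ : 2 * lev n / (s%:R - 1) = lev n / (s%:R - 1) *+ 2); last by rewrite mulr2n; lra.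
  by rewrite -mulr_natl expRM_natl sqrtr_sqr ger0_norm ?expR_ge0.
have -> : (expR (lev n / (s%:R - 1)))^-1 ^+ s.-1 = expR (- lev n).
  rewrite -expRN -expRM_natl -subn1 natrB 1?ltnW// mulrN mulrC divfK//.
  by rewrite gt_eqF.
have -> a b c e : a * b * c * e = b * c * (a * e) :> R by ring.
rewrite /pB ler_wpM2l ?mulr_ge0 ?expR_ge0// ler_wpM2l//.
rewrite ler_expR lerN2 -mulrA ler_wpM2l// /x0 ler_pM2r// lerXn2r ?nnegrE//.
- by rewrite mulr_ge0 ?sqr_ge0// ltW.
- by rewrite !mulr_ge0 ?invr_ge0 ?(ltW e0) ?(ltW D_gt0) ?(ltW (sd_gt0 _)).
- rewrite expr2 mulrA ler_wpM2l ?mulr_ge0 ?(ltW e0) ?(ltW D_gt0)//.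
  have /andP[_] := sd_bounds kstar.
  by rewrite -[X in X <= _]invrK lef_pV2 ?posrE ?invr_gt0.
Qed.

Let t := (1 - 2 * eps) / (1 + eps).

(** Each per-arm term becomes a multiple of [(M z)^-1], as in [rate]: the level by [M_scale], the
    tail of the mean by [M z <= z ^+ 2 / 2], the rest through [Mbar]. In the last term, [2 / D]
    bounds the gaps and [32 / (eps ^+ 4 * D ^+ 8)] is [8 / x0 ^+ 2]. *)
Lemma regret_finite_horizon (Mbar : R) :
  (forall k, suboptimal theta k -> M (gap theta k / sd theta k) <= Mbar) ->
  (regret pull P N theta <=
   (rate theta * (L / t ^+ 2 + eps ^- 2 + (1 + 2 / eps ^+ 2) * Mbar) +
    2 / D * (expR 1 * (32 / (eps ^+ 4 * D ^+ 8))) *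
      \sum_(2 * K <= n < N) expR (- lev n))%:E)%E.
Proof.
move=> MMbar; have [kstar kbest] := best_mean_attained theta K_gt0.
case/andP: (eps_bounds) => e0 e1.
have x00 : 0 < x0 by rewrite divr_gt0// exprn_gt0// mulr_gt0// exprn_gt0.
have t0 : 0 < t by rewrite divr_gt0//; lra.
have t1 : t <= 1 by rewrite ler_pdivrMr; lra.
apply: (le_trans (regret_le_tails algo eps_bounds sd_gt0 gap_ge L_ge0 lev_bounds
  twoK_le gap_le prob_over (fun n s => prob_under kbest (n := n) (s := s)))).
rewrite lee_fin; apply: lerD.
  rewrite /rate mulr_suml; apply: ler_sum => k subk.
  have g0 : 0 < gap theta k by rewrite -suboptimalE.
  pose z := gap theta k / sd theta k.
  have z0 : 0 < z by rewrite divr_gt0.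
  have Mz0 : 0 < M z by exact: M_gt0.
  rewrite -mulrA ler_pM2l// -/z.
  have sumO : \sum_(2 <= s < N) pO k s <= (eps * z) ^- 2 * 2 + 2 / eps ^+ 2.
    rewrite big_split /=; apply: lerD.
      have y0 : 0 < (eps * gap theta k / sd theta k) ^+ 2 / 2.
        by rewrite divr_gt0// exprn_gt0// -mulrA mulr_gt0.
      by apply: (le_trans (sum_expR_le _ y0)); rewrite invf_div mulrC mulrA.
    have y0 : 0 < eps ^+ 2 / 2 by rewrite divr_gt0// exprn_gt0.
    by apply: (le_trans (sum_expR_le _ y0)); rewrite invf_div.
  have scale : L / M (shrunk_ratio theta eps k) <= (M z)^-1 * (L / t ^+ 2).
    rewrite (_ : (M z)^-1 * _ = L / (t ^+ 2 * M z)); last by rewrite mulrC -mulrA -invfM.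
    rewrite ler_wpM2l// lef_pV2 ?posrE.
    - by apply: M_scale; rewrite t1 ltW.
    - by apply: M_gt0; rewrite mulr_gt0.
    - by rewrite mulr_gt0// exprn_gt0.
  have sqr : (eps * z) ^- 2 * 2 <= (M z)^-1 * eps ^- 2.
    rewrite exprMn invfM -mulrA mulrC ler_pM2r ?invr_gt0 ?exprn_gt0//.
    rewrite -[X in _ * X]invrK -invfM lef_pV2 ?posrE//.
      exact: M_le_sqr.
    by rewrite divr_gt0 ?exprn_gt0.
  have unit : 1 + 2 / eps ^+ 2 <= (M z)^-1 * ((1 + 2 / eps ^+ 2) * Mbar).
    rewrite mulrCA -[leLHS]mulr1 ler_wpM2l//.
      by rewrite addr_ge0// divr_ge0// sqr_ge0.
    by rewrite mulrC ler_pdivlMr// mul1r MMbar.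
  rewrite !mulrDr; lra.
rewrite -mulrA mulr_sumr mulr_sumr; apply: ler_sum => n _.
rewrite -mulr_sumr ler_wpM2l//; first by rewrite divr_ge0// ltW.
rewrite -mulrA (mulrC (expR (- _))) mulrA; apply: ler_wpM2r; first exact: expR_ge0.
rewrite ler_wpM2l ?expR_ge0// (le_trans (sum_natM_expR_pred_le _ x00))//.
rewrite /x0 le_eqVlt; apply/orP; left; apply/eqP.
by field; rewrite !gt_eqF.
Qed.

Let Mbar : R := M (2 / D ^+ 2).

Let Mbar_gt0 : 0 < Mbar.
Proof. by apply: M_gt0; rewrite divr_gt0// exprn_gt0. Qed.

Let M_le_Mbar k : M (gap theta k / sd theta k) <= Mbar.
Proof.
apply: ler_M; rewrite divr_ge0 ?gap_ge0 ?(ltW (sd_gt0 k))//=.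
rewrite ler_pdivrMr//; apply: (le_trans (gap_le k)).
have /andP[Dsd _] := sd_bounds k.
rewrite (_ : 2 / D = 2 / D ^+ 2 * D); last by field; rewrite gt_eqF.
by rewrite ler_wpM2l// divr_ge0// sqr_ge0.
Qed.

(** The underestimation term is not proportional to the rate and can be compared with it only if
    suboptimal arms are numerous; this is where the lower bound on their number enters. *)
Lemma rate_ge : D ^+ 2 * K%:R / Mbar <= rate theta.
Proof.
have numE : (num_suboptimal theta)%:R = \sum_(k < K | suboptimal theta k) 1 :> R.
  by rewrite /num_suboptimal -sum1_card natr_sum; apply: eq_bigl.
apply: (@le_trans _ _ (D / Mbar * (num_suboptimal theta)%:R)).
  rewrite (_ : D ^+ 2 * K%:R / Mbar = D / Mbar * (D * K%:R)); last by ring.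
  rewrite ler_wpM2l ?divr_ge0 ?(ltW D_gt0) ?(ltW Mbar_gt0)//.
  by case: in_Theta2.
rewrite numE mulr_sumr /rate; apply: ler_sum => k subk; rewrite mulr1.
have g0 : 0 < gap theta k by rewrite -suboptimalE.
have Mk0 : 0 < M (gap theta k / sd theta k) by rewrite M_gt0// divr_gt0.
apply: ler_pM; rewrite ?invr_ge0 ?(ltW D_gt0) ?(ltW Mbar_gt0)//.
  exact: gap_ge.
by rewrite lef_pV2 ?posrE ?M_le_Mbar.
Qed.

(** The power [D ^+ 11] collects [1] from the bound on the gaps, [8] from the sum over [s] and [2]
    from [rate_ge]. *)
Lemma regret_ratio_le : 0 < ln (N%:R : R) ->
  (regret pull P N theta * ((rate theta * ln N%:R)^-1)%:E <=
   (L / (t ^+ 2 * ln N%:R) +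
    (1 + 3 / eps ^+ 2) * ((1 + Mbar) / ln N%:R) +
    64 * expR 1 / eps ^+ 4 * (Mbar / (D ^+ 11 * K%:R * ln N%:R) *
      \sum_(2 * K <= n < N) expR (- lev n)))%:E)%E.
Proof.
move=> lnN0; case/andP: (eps_bounds) => e0 e1.
have K0 : 0 < K%:R :> R by rewrite ltr0n.
have rate0 : 0 < rate theta.
  by apply: lt_le_trans rate_ge; rewrite divr_gt0// mulr_gt0// exprn_gt0.
have rl0 : 0 < rate theta * ln N%:R by rewrite mulr_gt0.
rewrite lee_pdivrMr//; apply: (le_trans (regret_finite_horizon (fun k _ => M_le_Mbar k))).
rewrite -EFinM lee_fin.
set S := \sum_(_ <= _ < _) _.
have S0 : 0 <= S by rewrite sumr_ge0// => n _; exact: expR_ge0.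
have t20 : 0 < t ^+ 2 by rewrite exprn_gt0// divr_gt0//; lra.
have u0 : 0 < eps ^- 2 by rewrite invr_gt0 exprn_gt0.
have := rate_ge; move: Mbar_gt0; move: (Mbar) => m m0.
move: (t ^+ 2) t20 (ln N%:R) lnN0 (rate theta) rate0 {rl0}.
move=> T T0 l l0 r r0 rge.
rewrite [leRHS]mulrDl; apply: lerD.
  have -> : (L / (T * l) + (1 + 3 / eps ^+ 2) * ((1 + m) / l)) * (r * l) =
      r * (L / T + (1 + 3 / eps ^+ 2) * (1 + m)).
    by field; rewrite !gt_eqF.
  rewrite ler_pM2l//; have := mulr_ge0 (ltW u0) (ltW m0).
  by move: (eps ^- 2) u0 => u u0; lra.
set c := 64 * expR 1 / eps ^+ 4 * (m / (D ^+ 11 * K%:R * l) * S).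
have c0 : 0 <= c.
  rewrite /c !mulr_ge0 ?expR_ge0 ?invr_ge0 ?mulr_ge0 ?exprn_ge0 ?(ltW e0)
    ?(ltW D_gt0) ?(ltW m0) ?(ltW l0) ?(ltW K0)//.
apply: (@le_trans _ _ (c * (D ^+ 2 * K%:R / m * l))).
  rewrite /c le_eqVlt; apply/orP; left; apply/eqP.
  by move: (expR 1) => e; field; rewrite !gt_eqF.
by rewrite ler_wpM2l// ler_wpM2r// ltW.
Qed.

End finite_horizon.

(** * The limit *)

Section asymptotics.
Context (R : realType).

Lemma near_ln_ge (A : R) : \forall N \near \oo, A <= ln (N%:R : R).
Proof.
near=> N; rewrite -(expRK A) ler_ln ?posrE ?expR_gt0//.
  by near: N; exact: nbhs_infty_ger.
by near: N; exact: nbhs_infty_gtr.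
Unshelve. all: by end_near. Qed.

(** For [n >= 2], [1/n <= ln n - ln (n - 1)], and the right-hand sides telescope. *)
Lemma sum_inv_le_ln (a m : nat) : (2 <= a)%N -> (0 < m)%N ->
  \sum_(a <= n < m) n%:R^-1 <= ln (m%:R : R).
Proof.
move=> a2; case: m => // m _.
have step (j : nat) : j.+2%:R^-1 <= ln j.+2%:R - ln j.+1%:R :> R.
  have j2 : 0 < j.+2%:R :> R by rewrite ltr0n.
  rewrite -ln_div ?posrE ?ltr0n// -[leRHS]opprK lerNr -lnV ?posrE ?divr_gt0 ?ltr0n// invf_div.
  have -> : j.+1%:R / j.+2%:R = 1 + - j.+2%:R^-1 :> R.
    rewrite (_ : j.+1%:R = j.+2%:R - 1 :> R); last by rewrite -[j.+2%:R]natr1 addrK.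
    by rewrite mulrBl divff ?gt_eqF// mul1r.
  by rewrite le_ln1Dx// ltrN2 invf_lt1// ltr1n.
have sharp : \sum_(a <= n < m.+2) n%:R^-1 <= ln (m.+1%:R : R).
  elim: m => [|m IH]; first by rewrite big_geq ?ln1.
  have [am|ma] := leqP a m.+2; last by rewrite big_geq ?ln_ge0 ?ler1n.
  have -> : \sum_(a <= n < m.+3) n%:R^-1 = \sum_(a <= n < m.+2) n%:R^-1 + m.+2%:R^-1 :> R.
    by rewrite big_nat_recr.
  by apply: (le_trans (lerD IH (lexx _))); rewrite -lerBrDl.
apply: le_trans sharp; have [am|ma] := leqP a m.+1; last by rewrite !big_geq// ltnW.
by rewrite [leRHS]big_nat_recr//= lerDl invr_ge0.
Qed.

Lemma sum_lt_nat_le (a m n0 : nat) :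
  \sum_(a <= n < m) (n < n0)%:R <= n0%:R :> R.
Proof.
(* The second bound carries the induction: if [m < n0], the sum up to [m] is at most [m], leaving
   room for one more term. *)
suff [s1 _] : (\sum_(a <= n < m) (n < n0) <= n0)%N /\ (\sum_(a <= n < m) (n < n0) <= m)%N.
  by rewrite -natr_sum ler_nat.
elim: m => [|m [IH1 IH2]]; first by rewrite big_geq.
have [am|ma] := leqP a m; last by rewrite big_geq.
rewrite big_nat_recr//=; case: ltnP => [mn0|_]; last by rewrite addn0 IH1 (leq_trans IH2).
by rewrite addn1 !ltnS IH2 (leq_ltn_trans IH2 mn0).
Qed.

(* What [regret_ratio_le] needs for its right-hand side to tend to [c]. *)
Definition vanishing_errors (K : nat -> nat) (lev : nat -> nat -> R)
    (Delta : nat -> R) (c : R) : Prop :=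
  [/\ \forall N \near \oo, (2 * K N <= N)%N,
      forall N n m, (2 * K N <= n)%N -> (n <= m)%N ->
        0 <= lev (K N) n <= lev (K N) m,
      forall eta, 0 < eta -> \forall N \near \oo,
        lev (K N) N <= (c + eta) * ln N%:R,
      forall eta, 0 < eta -> \forall N \near \oo,
        1 + M (2 / Delta (K N) ^+ 2) <= eta * ln N%:R
    & forall eta, 0 < eta -> \forall N \near \oo,
        M (2 / Delta (K N) ^+ 2) / (Delta (K N) ^+ 11 * (K N)%:R * ln N%:R) *
        \sum_(2 * K N <= n < N) expR (- lev (K N) n) <= eta].

(** With [K] fixed, all terms in [Delta] are constants. The summand [expR (- lev)] is
    [K / (n (1 + ln (n / K))^alpha)], which is [o(1/n)], so its sum is [o(ln N)]. *)
Lemma vanishing_errors_fixed (K : nat -> nat) K0 (alpha : R) (Delta : nat -> R) :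
  (0 < K0)%N -> (forall N, K N = K0) -> 1 < alpha -> (forall k, 0 < Delta k) ->
  vanishing_errors K (lev_fixed alpha) Delta 1.
Proof.
move=> K00 KE alpha1 D0.
have KR : 0 < K0%:R :> R by rewrite ltr0n.
have ratio1 n : (2 * K0 <= n)%N -> 1 <= n%:R / K0%:R :> R.
  move=> Kn; rewrite ler_pdivlMr// mul1r ler_nat.
  by rewrite (leq_trans _ Kn)// leq_pmull.
have alpha0 : 0 < alpha by lra.
split.
- near=> N; rewrite KE; near: N; exact: nbhs_infty_ge.
- move=> N n m; rewrite KE => Kn nm; rewrite /lev_fixed /b.
  have n1 := ratio1 _ Kn; have ln1 := ln_ge0 n1.
  have nmR : n%:R / K0%:R <= m%:R / K0%:R :> R by rewrite ler_pM2r ?invr_gt0// ler_nat.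
  have lnm : ln (n%:R / K0%:R : R) <= ln (m%:R / K0%:R).
    by rewrite ler_ln ?posrE// (lt_le_trans ltr01)// (le_trans n1).
  have llnm : ln (1 + ln (n%:R / K0%:R : R)) <= ln (1 + ln (m%:R / K0%:R)).
    by rewrite ler_ln ?posrE ?lerD2l// ltr_wpDr// (le_trans ln1).
  rewrite addr_ge0//=; last by rewrite mulr_ge0 ?(ltW alpha0)// ln_ge0// lerDl.
  by rewrite lerD// ler_wpM2l// ltW.
- move=> eta eta0.
  pose delta := eta / (2 * alpha).
  have delta0 : 0 < delta by rewrite divr_gt0// mulr_gt0.
  near=> N; rewrite KE /lev_fixed /b.
  have l1 : 1 <= ln (N%:R : R) by near: N; exact: near_ln_ge.
  have N0 : 0 < N%:R :> R by near: N; exact: nbhs_infty_gtr.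
  have NK : 1 <= N%:R / K0%:R :> R.
    by apply: ratio1; near: N; exact: nbhs_infty_ge.
  have lK : ln (N%:R / K0%:R : R) <= ln N%:R.
    rewrite ler_ln ?posrE ?divr_gt0// ler_pdivrMr// ler_peMr ?(ltW N0)//.
    by rewrite ler1n.
  have lK0 := ln_ge0 NK.
  (* This is [ln x < x] at [x = delta * (1 + ln (N / K0))]; with this [delta], the part linear in
     [ln N] costs only [eta / 2] after multiplication by [alpha]. *)
  have : ln (1 + ln (N%:R / K0%:R : R)) <= delta * (1 + ln N%:R) - ln delta.
    have p0 : 0 < 1 + ln (N%:R / K0%:R : R) by lra.
    have /ltW := ln_sublinear (mulr_gt0 delta0 p0).
    rewrite lnM ?posrE// => h.
    have : delta * (1 + ln (N%:R / K0%:R)) <= delta * (1 + ln N%:R) by rewrite ler_pM2l// lerD2l.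
    lra.
  move=> /(ler_wpM2l (ltW alpha0)).
  have big : alpha * (delta - ln delta) <= eta / 2 * ln N%:R.
    rewrite -ler_pdivrMl ?divr_gt0//; near: N; exact: near_ln_ge.
  have E : alpha * (delta * (1 + ln N%:R) - ln delta) =
           alpha * (delta - ln delta) + eta / 2 * ln N%:R.
    by rewrite /delta; field; rewrite gt_eqF.
  rewrite E mulrDl mul1r; lra.
- move=> eta eta0; near=> N; rewrite KE.
  by rewrite -ler_pdivrMl//; near: N; exact: near_ln_ge.
- move=> eta eta0.
  set C := M (2 / Delta K0 ^+ 2) / (Delta K0 ^+ 11 * K0%:R).
  have C0 : 0 < C.
    have Dk := D0 K0.
    apply: divr_gt0; first by apply: M_gt0; rewrite divr_gt0 ?exprn_gt0.
    by rewrite mulr_gt0 ?exprn_gt0.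
  (* Half of [eta] goes to the terms of size [K0 * delta / n], the other half to the finitely many
     [n < n0]. *)
  pose delta := eta / (C * K0%:R * 2).
  have delta0 : 0 < delta by rewrite divr_gt0// mulr_gt0// mulr_gt0.
  have Kdelta : K0%:R * delta = eta / (C * 2).
    by rewrite /delta; move: (C) C0 => C' C'0; field; rewrite !gt_eqF.
  clearbody delta.
  (* Once [n / K0 >= expR (expR A)], [1 + ln (n / K0)] is at least [delta^-1], and its power
     [- alpha] is at most [delta]. *)
  pose A := Num.max 0 (- ln delta).
  have [n0 _ n0P] : \forall n \near \oo, K0%:R * expR (expR A) <= n%:R :> R.
    exact: nbhs_infty_ger.
  have small n : (2 * K0 <= n)%N ->
      expR (- lev_fixed alpha K0 n) <= (n < n0)%:R + K0%:R * delta * n%:R^-1.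
    move=> Kn; have n1 := ratio1 _ Kn; have ln1 := ln_ge0 n1.
    have nR : 0 < n%:R :> R by rewrite ltr0n (leq_trans _ Kn)// muln_gt0.
    have lln1 : 0 <= ln (1 + ln (n%:R / K0%:R : R)) by rewrite ln_ge0// lerDl.
    case: ltnP => [_|n0n].
      rewrite -[leLHS]addr0 lerD//.
        by rewrite -[leRHS]expR0 ler_expR oppr_le0 addr_ge0// mulr_ge0// ltW.
      by rewrite !mulr_ge0 ?(ltW delta0) ?invr_ge0.
    have nbig : expR (expR A) <= n%:R / K0%:R by rewrite ler_pdivlMr// mulrC; exact: n0P.
    rewrite add0r /lev_fixed /b opprD expRD expRN lnK ?posrE ?divr_gt0//.
    rewrite invf_div mulrAC ler_wpM2r ?invr_ge0 ?(ltW nR)// ler_wpM2l ?(ltW KR)//.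
    rewrite -(lnK (x := delta)) ?posrE// ler_expR lerNl.
    have A1 : expR A <= ln (n%:R / K0%:R).
      by rewrite -[leLHS]expRK ler_ln ?posrE ?expR_gt0// divr_gt0.
    have A2 : A <= ln (1 + ln (n%:R / K0%:R)).
      rewrite -[leLHS]expRK ler_ln ?posrE ?expR_gt0//; lra.
    have A3 : - ln delta <= A by rewrite le_max lexx orbT.
    apply: (le_trans A3); apply: (le_trans A2).
    by rewrite ler_peMl// ltW.
  have eC : 0 < eta / (C * 2) by rewrite divr_gt0// mulr_gt0.
  near=> N; rewrite KE.
  have l0 : 1 <= ln (N%:R : R) by near: N; exact: near_ln_ge.
  have N0 : (0 < N)%N by near: N; exact: nbhs_infty_gt.
  have lpos : 0 < ln (N%:R : R) by lra.
  have -> : M (2 / Delta K0 ^+ 2) / (Delta K0 ^+ 11 * K0%:R * ln N%:R) =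
      C / ln N%:R.
    by rewrite /C -[RHS]mulrA -invfM.
  rewrite mulrAC ler_pdivrMr// -ler_pdivlMl//.
  apply: (@le_trans _ _ (n0%:R + K0%:R * delta * ln N%:R)).
    apply: (@le_trans _ _ (\sum_(2 * K0 <= n < N) ((n < n0)%:R + K0%:R * delta * n%:R^-1))).
      rewrite big_nat_cond [leRHS]big_nat_cond; apply: ler_sum => n.
      by rewrite andbT => /andP[Kn _]; exact: small.
    rewrite big_split /= lerD//.
      exact: sum_lt_nat_le.
    rewrite -mulr_sumr ler_wpM2l ?mulr_ge0 ?(ltW KR) ?(ltW delta0)//.
    by rewrite sum_inv_le_ln// leq_pmulr.
  have big : n0%:R <= eta / (C * 2) * ln N%:R.
    by rewrite -ler_pdivrMl//; near: N; exact: near_ln_ge.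
  have -> : C^-1 * (eta * ln N%:R) = eta / (C * 2) * ln N%:R + K0%:R * delta * ln N%:R.
    by rewrite Kdelta; move: (C) C0 => C' C'0; field; rewrite gt_eqF.
  by rewrite lerD2r.
Unshelve. all: by end_near. Qed.

(** At time [N] the level is [(1 - (1 - q) (zeta + e N)) ln N], whence the constant. The sum of
    [expR (- lev)] is at most [K^(1-q) ln N], so the last error is at most [2 / (Delta^15 K^q)],
    which a subpolynomial [Delta] sends to zero. *)
Lemma vanishing_errors_growing (K : nat -> nat) (zeta q : R) (Delta : nat -> R) :
  (forall N, 0 < K N)%N -> 0 < zeta < 1 -> power_growth K zeta ->
  K @ \oo --> \oo -> 0 < q -> (forall k, 0 < Delta k) ->
  subpolynomial_decay Delta ->
  vanishing_errors K (lev_growing q) Delta (1 - zeta + zeta * q).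
Proof.
move=> K0 /andP[z0 z1] [e e0 Kgrow] Kcvg q0 D0 [Dto0 Dsub].
have KR N : 0 < (K N)%:R :> R by rewrite ltr0n.
have KR1 N : 1 <= (K N)%:R :> R by rewrite ler1n.
have near_lnK : \forall N \near \oo, ln ((K N)%:R : R) = (zeta + e N) * ln N%:R.
  by move: Kgrow; apply: filterS => N ->; rewrite ln_powR.
have near_e (eta : R) : 0 < eta -> \forall N \near \oo, `|e N| <= eta.
  by move=> eta0; have /cvgr0Pnorm_lt/(_ _ eta0) := e0; apply: filterS => N /ltW.
have nearK Q : (\forall k \near \oo, Q k) -> \forall N \near \oo, Q (K N).
  by move=> HQ; exact: Kcvg HQ.
have near_KN : \forall N \near \oo, (2 * K N <= N)%N.
  near=> N.
  have lnKE : ln ((K N)%:R : R) = (zeta + e N) * ln N%:R by near: N.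
  have eN : `|e N| <= (1 - zeta) / 2 by near: N; apply: near_e; lra.
  have N0 : 0 < N%:R :> R by near: N; exact: nbhs_infty_gtr.
  have lN0 : 0 <= ln (N%:R : R) by near: N; exact: near_ln_ge.
  have big : ln (2 : R) <= (1 - zeta) / 2 * ln N%:R.
    by rewrite -ler_pdivrMl; [near: N; exact: near_ln_ge|lra].
  rewrite -(ler_nat R) natrM -ler_ln ?posrE ?mulr_gt0// lnM ?posrE// lnKE.
  have : (zeta + e N) * ln N%:R <= (zeta + (1 - zeta) / 2) * ln N%:R.
    by rewrite ler_wpM2r// lerD2l (le_trans (ler_norm _)).
  lra.
have near_D eps : 0 < eps -> \forall N \near \oo, 1 <= Delta (K N) * (K N)%:R `^ eps.
  move=> /Dsub /cvgryPge /(_ 1) H; exact: (nearK (fun k => 1 <= Delta k * k%:R `^ eps)).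
have near_D1 : \forall N \near \oo, Delta (K N) <= 1.
  by apply: (nearK (fun k => Delta k <= 1)); exact: cvgr_le Dto0 _ ltr01.
have Kpow N : (K N)%:R `^ (1 - q) <= (K N)%:R :> R.
  by rewrite -[leRHS]powRr1 ?ler0n// ler_powR//; lra.
have Kpow0 N : 0 < (K N)%:R `^ (1 - q) :> R by rewrite powR_gt0.
split => //.
- move=> N n m Kn nm; rewrite /lev_growing.
  have n1 : 1 <= n%:R / (K N)%:R `^ (1 - q) :> R.
    rewrite ler_pdivlMr// mul1r (le_trans (Kpow N))// ler_nat.
    by rewrite (leq_trans _ Kn)// leq_pmull.
  have nmR : n%:R / (K N)%:R `^ (1 - q) <= m%:R / (K N)%:R `^ (1 - q) :> R.
    by rewrite ler_pM2r ?invr_gt0// ler_nat.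
  have n0 := lt_le_trans ltr01 n1; have m0 := lt_le_trans n0 nmR.
  by rewrite ln_ge0//= ler_ln.
- move=> eta eta0.
  have q10 : 0 < `|1 - q| + 1 by have := normr_ge0 (1 - q); lra.
  have c0 : 0 < eta / (`|1 - q| + 1) by rewrite divr_gt0.
  near=> N.
  have lnKE : ln ((K N)%:R : R) = (zeta + e N) * ln N%:R by near: N.
  have N0 : 0 < N%:R :> R by near: N; exact: nbhs_infty_gtr.
  have lN0 : 0 <= ln (N%:R : R) by near: N; exact: near_ln_ge.
  have eN : `|e N| <= eta / (`|1 - q| + 1) by near: N; exact: near_e.
  rewrite /lev_growing ln_div ?posrE// ln_powR lnKE.
  have : `|(1 - q) * e N| <= eta.
    rewrite normrM; apply: (@le_trans _ _ ((`|1 - q| + 1) * `|e N|)).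
      by rewrite ler_wpM2r// lerDl.
    by rewrite mulrC -ler_pdivlMr.
  rewrite ler_norml => /andP[lo _].
  have : - ((1 - q) * e N) * ln N%:R <= eta * ln N%:R by rewrite ler_wpM2r// lerNl.
  lra.
- move=> eta eta0; have eps0 : 0 < eta / 4 by rewrite divr_gt0.
  near=> N.
  have D1 : Delta (K N) <= 1 by near: N.
  have DK : 1 <= Delta (K N) * (K N)%:R `^ (eta / 4) by near: N; exact: near_D.
  have KN : (2 * K N <= N)%N by near: N.
  have lK : ln ((K N)%:R : R) <= ln N%:R.
    by rewrite ler_ln ?posrE ?ltr0n ?(leq_trans _ KN)// ?ler_nat ?muln_gt0 ?K0//
      (leq_trans _ KN)// leq_pmull.
  have big : 1 + ln (5 : R) / 2 <= eta / 2 * ln N%:R.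
    by rewrite -ler_pdivrMl ?divr_gt0//; near: N; exact: near_ln_ge.
  set x := Delta (K N) in D1 DK *; have x0 : 0 < x by exact: D0.
  have lnx : - ln x <= eta / 4 * ln (K N)%:R.
    have := ln_ge0 DK; rewrite lnM ?posrE ?powR_gt0// ln_powR; lra.
  suff : M (2 / x ^+ 2) <= ln 5 / 2 - 2 * ln x.
    have : eta / 4 * ln (K N)%:R <= eta / 4 * ln N%:R by rewrite ler_pM2l.
    lra.
  have x4 : 0 < x ^+ 4 by rewrite exprn_gt0.
  (* As [x <= 1], [1 + 4 / x^4 <= 5 / x^4]. *)
  apply: (@le_trans _ _ (2^-1 * ln (5 / x ^+ 4))).
    rewrite /M ler_pM2l// ler_ln ?posrE ?divr_gt0// ?ltr_wpDr ?sqr_ge0//.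
    rewrite ler_pdivlMr// mulrDl mul1r.
    have -> : (2 / x ^+ 2) ^+ 2 * x ^+ 4 = 4 by field; rewrite gt_eqF.
    have x41 : x ^+ 4 <= 1 by rewrite exprn_ile1 ?(ltW x0).
    by lra.
  by rewrite ln_div ?posrE// lnXn// -mulr_natl; lra.
(* With [y = K^(q/30)], [K^q] is [y^30]: fifteen factors offset [Delta^15] ([11] from the error
   term, [4] from the bound on [M]), and one of the others exceeds [2 / eta]. *)
- move=> eta eta0; have eps0 : 0 < q / 30 by rewrite divr_gt0.
  near=> N.
  have DK : 1 <= Delta (K N) * (K N)%:R `^ (q / 30) by near: N; exact: near_D.
  have N0 : (0 < N)%N by near: N; exact: nbhs_infty_gt.
  have lN0 : 1 <= ln (N%:R : R) by near: N; exact: near_ln_ge.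
  have Kbig : Num.max 1 (2 / eta) <= (K N)%:R `^ (q / 30).
    have : Num.max 1 (2 / eta) `^ (30 / q) <= (K N)%:R.
      near: N; apply: (nearK (fun k => _ <= k%:R)); exact: nbhs_infty_ger.
    have A0 : 0 <= Num.max 1 (2 / eta) by rewrite le_max ler01.
    have qE : 30 / q * (q / 30) = 1 by field; rewrite gt_eqF.
    move=> AK; rewrite -[leLHS]powRr1// -[X in _ `^ X <= _]qE (powRrM _ (30 / q)).
    by apply: ge0_ler_powR; rewrite ?nnegrE ?powR_ge0 ?(ltW eps0) ?(ltW (KR N)).
  set x := Delta (K N) in DK *; have x0 : 0 < x by exact: D0.
  set y := (K N)%:R `^ (q / 30) in DK Kbig.
  have y1 : 1 <= y by apply: le_trans Kbig; rewrite le_max lexx.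
  have y2 : 2 / eta <= y by apply: le_trans Kbig; rewrite le_max lexx orbT.
  have y0 : 0 < y by exact: lt_le_trans y1.
  have KqE : (K N)%:R `^ (1 - q) = (K N)%:R / y ^+ 30.
    apply/(canRL (mulfK _)); first by rewrite gt_eqF// exprn_gt0.
    rewrite -powR_mulrn ?(ltW y0)// -powRrM -powRD; last by rewrite (gt_eqF (KR N)) implybT.
    by rewrite (_ : 1 - q + q / 30 * 30 = 1) ?powRr1//; field.
  have l0 : 0 < ln (N%:R : R) by lra.
  have sumE : \sum_(2 * K N <= n < N) expR (- lev_growing q (K N) n) <=
      (K N)%:R / y ^+ 30 * ln N%:R.
    apply: (@le_trans _ _ ((K N)%:R / y ^+ 30 * \sum_(2 * K N <= n < N) n%:R^-1)).
      rewrite mulr_sumr big_nat_cond [leRHS]big_nat_cond; apply: ler_sum => n.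
      rewrite andbT => /andP[Kn _]; rewrite /lev_growing -KqE expRN lnK ?invf_div//.
      by rewrite posrE divr_gt0// ltr0n (leq_trans _ Kn)// muln_gt0 K0.
    rewrite ler_wpM2l ?divr_ge0 ?exprn_ge0 ?(ltW y0)//.
    by rewrite sum_inv_le_ln// leq_pmulr.
  have Mx : M (2 / x ^+ 2) <= 2 / x ^+ 4.
    apply: (le_trans (M_le_sqr _)); rewrite le_eqVlt; apply/orP; left; apply/eqP.
    by field; rewrite gt_eqF.
  have M0 : 0 <= M (2 / x ^+ 2) by rewrite ltW// M_gt0// divr_gt0// exprn_gt0.
  apply: (@le_trans _ _ (2 / x ^+ 4 / (x ^+ 11 * (K N)%:R * ln N%:R) *
    ((K N)%:R / y ^+ 30 * ln N%:R))).
    apply: ler_pM => //.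
    - by rewrite divr_ge0// !mulr_ge0 ?exprn_ge0 ?(ltW x0) ?(ltW l0).
    - by rewrite sumr_ge0// => n _; exact: expR_ge0.
    - by rewrite ler_wpM2r// invr_ge0 !mulr_ge0 ?exprn_ge0 ?(ltW x0) ?(ltW l0).
  have -> : 2 / x ^+ 4 / (x ^+ 11 * (K N)%:R * ln N%:R) * ((K N)%:R / y ^+ 30 * ln N%:R) =
    2 / ((x * y) ^+ 15 * y ^+ 14 * y).
    by field; rewrite !gt_eqF.
  rewrite ler_pdivrMr; last by rewrite !mulr_gt0 ?exprn_gt0 ?mulr_gt0.
  rewrite -ler_pdivrMl// mulrC (le_trans y2)// ler_peMl ?(ltW y0)//.
  by rewrite mulr_ege1// exprn_ege1.
Unshelve. all: by end_near. Qed.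

End asymptotics.

Lemma limn_esup_le_near (R : realType) (u : nat -> \bar R) (l : \bar R) :
  (\forall n \near \oo, (u n <= l)%E) -> (limn_esup u <= l)%E.
Proof.
move=> [n0 _ n0P].
apply: (@le_trans _ _ (ereal_sup (u @` [set n | (n0 <= n)%N]))).
  by apply: ereal_inf_lbound; exists [set n | (n0 <= n)%N] => //; exists n0.
by apply: ge_ereal_sup => _ [n /= n0n <-]; exact: n0P.
Qed.

Lemma sup_over_le (R : realType) (T : Type) (A : set T) (f : T -> \bar R) (l : \bar R) :
  (0 <= l)%E -> (forall x, A x -> (f x <= l)%E) -> (sup_over A f <= l)%E.
Proof.
by move=> l0 fl; rewrite /sup_over; case: ifP => // _; apply: ge_ereal_sup => _ [x /fl + <-].
Qed.

Theorem theorem4 (R : realType) (K : nat -> nat) (zeta q alpha : R)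
  (lev : nat -> nat -> R) (Delta : nat -> R)
  (d : nat -> measure_display) (Omega : forall N, measurableType (d N))
  (P : forall N, param R (K N) -> probability (Omega N) R)
  (X : forall N, 'I_(K N) -> nat -> {mfun Omega N >-> R})
  (pull : forall N, nat -> Omega N -> 'I_(K N))
  (K_gt0 : forall N, (0 < K N)%N)
  (regime :
     [/\ 0 < zeta < 1, power_growth K zeta, K @ \oo --> \oo, 0 < q
       & lev = lev_growing q] \/
     [/\ zeta = 0, exists K0, forall N, K N = K0, 1 < alpha
       & lev = lev_fixed alpha])
  (Delta_gt0 : forall k, 0 < Delta k)
  (Delta_subpoly : subpolynomial_decay Delta)
  (arms : forall N, normal_arms (P N) (X N))
  (algo : forall N, ucb_large (X N) (pull N) (lev (K N)) N) :
  (limn_esup (fun N =>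
     sup_over (Theta2 (Delta (K N)))
       (fun theta => regret (pull N) (P N) N theta *
                     ((rate theta * ln N%:R)^-1)%:E))
   <= (1 - zeta + zeta * q)%:E)%E.
Proof.
set c := 1 - zeta + zeta * q.
have [c0 [near_K lev_mono lev_le M_le tail_le]] :
    0 < c /\ vanishing_errors K lev Delta c.
  case: regime => [[zeta01 growth Kcvg q0 ->]|[zeta0 [K0 KE] alpha1 ->]].
    split; last exact: vanishing_errors_growing.
    by case/andP: zeta01 => z0 z1; rewrite /c addr_gt0 ?subr_gt0 ?mulr_gt0.
  have -> : c = 1 by rewrite /c zeta0; ring.
  split => //; apply: (vanishing_errors_fixed _ KE) => //.
  by rewrite -(KE 0%N).
apply/lee_addgt0Pr => eta eta0; apply: limn_esup_le_near; rewrite -EFinD.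
(* As [t >= 1 - 3 eps], [t^2 >= 1 - 6 eps], and [6 eps (c + eta / 2) = eta / 4]. The level term then
   stays below [c + eta / 2], leaving [eta / 4] for each of the two errors. *)
pose eps := eta / (24 * (c + eta / 2)).
have den0 : 0 < 24 * (c + eta / 2) by lra.
have eps0 : 0 < eps by rewrite divr_gt0.
have eps1 : eps < 12^-1.
  rewrite ltr_pdivrMr//; lra.
have eps_bounds : 0 < eps < 2^-1 by rewrite eps0; lra.
pose t := (1 - 2 * eps) / (1 + eps).
have t0 : 0 < t by rewrite divr_gt0//; lra.
have t2 : c + eta / 4 <= t ^+ 2 * (c + eta / 2).
  have t3 : 1 - 3 * eps <= t by rewrite ler_pdivlMr; nra.
  have t6 : 1 - 6 * eps <= t ^+ 2.
    apply: (@le_trans _ _ ((1 - 3 * eps) ^+ 2)); first nra.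
    by rewrite lerXn2r ?nnegrE//; lra.
  have -> : c + eta / 4 = (1 - 6 * eps) * (c + eta / 2).
    by rewrite /eps; field; rewrite gt_eqF//; lra.
  by rewrite ler_wpM2r//; lra.
pose A := 1 + 3 / eps ^+ 2; pose B := 64 * expR 1 / eps ^+ 4.
have A0 : 0 < A by rewrite addr_gt0// divr_gt0// exprn_gt0.
have B0 : 0 < B by rewrite divr_gt0 ?exprn_gt0// mulr_gt0 ?expR_gt0.
have etaA : 0 < eta / (4 * A) by rewrite divr_gt0// mulr_gt0.
have etaB : 0 < eta / (4 * B) by rewrite divr_gt0// mulr_gt0.
have eta4 : 0 < eta / 4 by rewrite divr_gt0.
have quarter a : 0 < a -> a^-1 * (eta / 4) = eta / (4 * a).
  by move=> a0; field; rewrite gt_eqF.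
near=> N.
have KN : (2 * K N <= N)%N by near: N.
have lnN : 1 <= ln (N%:R : R) by near: N; exact: near_ln_ge.
have lnN0 : 0 < ln (N%:R : R) by lra.
have levN : lev (K N) N <= (c + eta / 4) * ln N%:R by near: N; exact: lev_le.
have MN : 1 + M (2 / Delta (K N) ^+ 2) <= eta / (4 * A) * ln N%:R by near: N; exact: M_le.
have tailN : M (2 / Delta (K N) ^+ 2) / (Delta (K N) ^+ 11 * (K N)%:R * ln N%:R) *
    \sum_(2 * K N <= n < N) expR (- lev (K N) n) <= eta / (4 * B).
  by near: N; exact: tail_le.
(* All conditions on [N] precede [theta], so the estimate is uniform over the parameter set. *)
apply: sup_over_le => [|theta thetaT]; first by rewrite lee_fin; lra.
have L0 : 0 <= lev (K N) N by have /andP[] := lev_mono N N N KN (leqnn N).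
have lev_bounds n : (2 * K N <= n < N)%N -> 0 <= lev (K N) n <= lev (K N) N.
  by move=> /andP[Kn /ltnW nN]; exact: lev_mono.
apply: (le_trans (regret_ratio_le (K_gt0 N) (arms N) (algo N) eps_bounds
  (Delta_gt0 (K N)) thetaT L0 lev_bounds KN lnN0)).
rewrite lee_fin -/t -/A -/B.
have term1 : lev (K N) N / (t ^+ 2 * ln N%:R) <= c + eta / 2.
  have tl0 : 0 < t ^+ 2 * ln N%:R by rewrite mulr_gt0// exprn_gt0.
  rewrite ler_pdivrMr//; apply: (le_trans levN).
  by rewrite (mulrA (c + eta / 2)) ler_pM2r// [leRHS]mulrC.
have term2 : A * ((1 + M (2 / Delta (K N) ^+ 2)) / ln N%:R) <= eta / 4.
  rewrite -ler_pdivlMl// ler_pdivrMr//; apply: (le_trans MN).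
  by rewrite ler_pM2r// quarter.
have term3 : B * (M (2 / Delta (K N) ^+ 2) / (Delta (K N) ^+ 11 * (K N)%:R * ln N%:R) *
    \sum_(2 * K N <= n < N) expR (- lev (K N) n)) <= eta / 4.
  by rewrite -ler_pdivlMl//; apply: (le_trans tailN); rewrite quarter.
lra.
Unshelve. all: by end_near. Qed.
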